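(* The set $\mathcal{A}=\big\{f\in\bigcap_{p<1}H^p : \beta(f)\notin \ell^\infty\big\}$ is a $G_\delta$ and dense subset of $\bigcap_{p<1}H^p$.
   Context: $\mathbb{D}$ is the open unit disc in $\mathbb{C}$. For $0<p<1$, $H^p$ is the set of holomorphic $f:\mathbb{D}\to\mathbb{C}$ with $\sup_{0<r<1}\frac{1}{2\pi}\int_0^{2\pi}|f(re^{i\theta})|^p\,d\theta<+\infty$, with metric $d_p(f,g)=\sup_{0<r<1}\frac{1}{2\pi}\int_0^{2\pi}|f(re^{i\theta})-g(re^{i\theta})|^p\,d\theta$. The space $\bigcap_{p<1}H^p$ (intersection over $0<p<1$) carries the metric $d(f,g)=\sum_{n=1}^\infty 2^{-n}\frac{d_{p_n}(f,g)}{1+d_{p_n}(f,g)}$, where $(p_n)$ is any strictly increasing sequence in $(0,1)$ converging to $1$; equivalently, convergence in this space is convergence in $H^p$ for every $0<p<1$. For a holomorphic function $f$ on $\mathbb{D}$, $\beta(f)=(\beta_k(f))_{k=0}^\infty$ is the sequence of its Taylor coefficients at $0$, i.e. $f(z)=\sum_{k\ge 0}\beta_k(f)z^k$. $\ell^\infty$ is the set of bounded complex sequences. *)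

(* Defs.v *)
From HB Require Import structures.
From mathcomp Require Import all_boot all_order all_algebra complex.
From mathcomp Require Import all_classical all_reals all_analysis.
From mathcomp Require Export borel_hierarchy.

Set Implicit Arguments.
Unset Strict Implicit.
Unset Printing Implicit Defensive.

Import Order.TTheory GRing.Theory Num.Theory numFieldNormedType.Exports.

Local Open Scope classical_set_scope.
Local Open Scope ring_scope.

(* The regular module [R[i]^o] is what carries the topology and the norm of
   the complex plane; derivatives taken in it are complex derivatives. *)
Notation Cplx R := (R[i]^o).

Definition unit_disc (R : realType) : set (Cplx R) := [set z | `|z| < 1].

(* A function on the disc is represented by its extension by [0] to the whole
   plane, so that two functions are equal iff they agree on the disc. *)
Definition holomorphic_on_disc (R : realType) (f : Cplx R -> Cplx R) : Prop :=
  (forall z, unit_disc z -> derivable f z 1) /\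
  (forall z, ~ unit_disc z -> f z = 0).

Definition circle_point (R : realType) (r t : R) : Cplx R :=
  ((r * cos t) +i* (r * sin t))%C.

(* [Normc.normc] is the modulus with values in [R] rather than in [R[i]]. *)
Definition circle_mean (R : realType) (p : R) (f : Cplx R -> Cplx R) (r : R)
    : \bar R :=
  (((2 * pi)^-1)%:E *
   \int[@lebesgue_measure R]_(t in `[0%R, (2 * pi)%R])
     (Normc.normc (f (circle_point r t)) `^ p)%:E)%E.

Definition hardy_sup (R : realType) (p : R) (f : Cplx R -> Cplx R) : \bar R :=
  ereal_sup [set circle_mean p f r | r in `]0%R, 1%R[].

Definition hardy (R : realType) (p : R) : set (Cplx R -> Cplx R) :=
  [set f | holomorphic_on_disc f /\ (hardy_sup p f < +oo)%E].

(* The supremum is finite when [f] and [g] are in [hardy p]; the junk value [0]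
   of [fine] at infinity is then not used. *)
Definition hardy_dist (R : realType) (p : R) (f g : Cplx R -> Cplx R) : R :=
  fine (hardy_sup p (f \- g)).

Definition hardy_cap (R : realType) : set (Cplx R -> Cplx R) :=
  [set f | forall p : R, 0 < p < 1 -> hardy p f].

(* Sequences are indexed from [0]: [p n] is the exponent usually written
   p_(n+1), whence the weight 2^-(n+1). *)
Definition hardy_cap_dist (R : realType) (p : nat -> R)
    (f g : Cplx R -> Cplx R) : R :=
  limn (series (fun n =>
    2 ^- n.+1 * (hardy_dist (p n) f g / (1 + hardy_dist (p n) f g)))).

(* The exponents are a parameter of the type because its topology is the one
   of the metric [hardy_cap_dist p]. *)
Record hardy_cap_space (R : realType) (p : nat -> R) := HardyCapSpace {
  hardy_cap_fun :> Cplx R -> Cplx R;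
  hardy_cap_funP : hardy_cap hardy_cap_fun }.

Section hardy_cap_topology.
Context (R : realType) (p : nat -> R).
Local Notation T := (hardy_cap_space p).

Definition hardy_cap_ball (f : T) (e : R) : set T :=
  [set g : T | hardy_cap_dist p f g < e].

Definition hardy_cap_open (U : set T) : Prop :=
  forall f, U f -> exists2 e : R, 0 < e & hardy_cap_ball f e `<=` U.

Let hardy_cap_openT : hardy_cap_open setT.
Proof. by move=> f _; exists 1. Qed.

Let hardy_cap_openI : setI_closed hardy_cap_open.
Proof.
move=> U V oU oV f [/oU[e e0 eU] /oV[d d0 dV]].
exists (Num.min e d); first by rewrite lt_min e0 d0.
move=> g; rewrite /hardy_cap_ball /= lt_min => /andP[fge fgd].
by split; [exact: eU | exact: dV].
Qed.

Let hardy_cap_open_bigU (I : Type) (U : I -> set T) :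
  (forall i, hardy_cap_open (U i)) -> hardy_cap_open (\bigcup_i U i).
Proof.
move=> oU f [i _ /oU[e e0 eU]]; exists e => //.
by move=> g /eU Ug; exists i.
Qed.

HB.instance Definition _ := gen_eqMixin T.
HB.instance Definition _ := gen_choiceMixin T.
HB.instance Definition _ := isOpenTopological.Build T
  hardy_cap_openT hardy_cap_openI hardy_cap_open_bigU.

End hardy_cap_topology.

Definition taylor_coef (R : realType) (f : Cplx R -> Cplx R) (k : nat)
    : Cplx R :=
  derive1n k f 0 / k`!%:R.

Definition ell_infty (R : realType) : set (nat -> Cplx R) := bounded_fun.

Definition unbounded_taylor (R : realType) (p : nat -> R)
    : set (hardy_cap_space p) :=
  [set f | ~ ell_infty (taylor_coef f)].
Arguments unbounded_taylor {R} p.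

(* Main.v *)
Require Import Defs.
From mathcomp Require Import all_boot all_order all_algebra complex.
From mathcomp Require Import all_classical all_reals all_analysis.
From mathcomp Require Import zify ring lra.
Import Order.TTheory GRing.Theory Num.Theory numFieldNormedType.Exports.
Local Open Scope classical_set_scope.
Local Open Scope ring_scope.
Set Implicit Arguments.
Unset Strict Implicit.
Unset Printing Implicit Defensive.

(** A function has unbounded Taylor coefficients iff for every [N] one of its
    coefficients has modulus greater than [N]. So the set in question is the
    intersection over [N] of the sets [large_coef N], and it is a countable
    intersection of open sets as soon as every Taylor coefficient depends
    continuously on the function.

    Continuity follows from a bound [|beta_k(u)|^p <= C A] valid whenever all
    the means of [|u|^p] over circles of radius less than one are at most [A]
    ([taylor_coef_power_mean]). For [p < 1] such a bound does not come from
    Cauchy's formula alone, which involves the mean of [|u|]. The proof writes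
    [|u| = |u|^(1-p) |u|^p] and bounds the first factor by the supremum [S] of
    [|u|] weighted by a power of the distance to the circle of radius [1/2];
    Cauchy's formula then gives [S <= K A S^(1-p)], hence [S^p <= K A]
    ([weighted_sup_bound]).

    Since holomorphic means here just complex differentiable, Cauchy's formula
    has to start from Goursat's lemma. It is proved for a closed form
    [P dx + Q dy] on a rectangle by repeated quartering
    ([goursat_rectangle]) and applied to [f(z) dz / z] in the coordinates
    [(ln r, t)] ([closed_form_polar]), where a full circle is a side of a
    rectangle and the two radial sides cancel by periodicity. The average of
    [f] over a circle is therefore independent of the radius, and it is equal to
    [f 0], even if [f] is merely continuous at one point
    ([circle_avg_center]). Applied to [w (f w - f z) / (w - z)], this is
    Cauchy's formula; expanding its kernel in a geometric series gives the
    Taylor expansion.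

    For density, let [h] be the sum of [H_k z^k] with [H_k] the harmonic
    numbers, which are unbounded. Since [(1 - z) h(z) = - ln (1 - z)] is bounded
    by a multiple of [|1 - z|^(-d)] for every [d > 0], [|h|^q] is at most a
    multiple of [|1 - z|^(-s)] with [s < 1], whose means over circles are bounded:
    [h] is in every [H^q] with [q < 1]. If the coefficients of [f] are bounded,
    then those of [f + c h] are unbounded for every [c > 0], and [f + c h] tends
    to [f] as [c] tends to [0]. *)

Local Notation nc := Normc.normc.

(** * Moduli, continuity and differentiability in the complex plane *)

Section Basics.
Context {R : realType}.
Implicit Types (z w : Cplx R).

Lemma norm_normc z : `|z| = (nc z)%:C%C :> R[i].
Proof. by rewrite normc_def; case: z. Qed.

Lemma normcr (x : R) : nc (x%:C)%C = `|x|.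
Proof. by rewrite /Normc.normc /= expr0n /= addr0 sqrtr_sqr. Qed.

Lemma normc_nat n : nc (n%:R : Cplx R) = n%:R.
Proof. by rewrite -[n%:R](rmorph_nat (@real_complex R)) normcr ger0_norm. Qed.

Lemma normc_ge0 z : 0 <= nc z.
Proof. by case: z => a b; rewrite sqrtr_ge0. Qed.

Lemma normc_sqr z : nc z ^+ 2 = complex.Re z ^+ 2 + complex.Im z ^+ 2.
Proof. by case: z => a b; rewrite sqr_sqrtr // addr_ge0 ?sqr_ge0. Qed.

Lemma ler_normcD z w : nc (z + w) <= nc z + nc w.
Proof. exact: le_normcD. Qed.

Lemma normc_opp z : nc (- z) = nc z.
Proof. exact: normcN. Qed.

Lemma normcB z w : nc (z - w) = nc (w - z).
Proof. by rewrite -normc_opp opprB. Qed.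

Lemma normc_mul z w : nc (z * w) = nc z * nc w.
Proof. exact: Normc.normcM. Qed.

Lemma normc_inv z : nc z^-1 = (nc z)^-1.
Proof. exact: Normc.normcV. Qed.

Lemma normc_exp z n : nc (z ^+ n) = nc z ^+ n.
Proof.
by elim: n => [|n ih]; rewrite ?expr0 ?Normc.normc1// !exprS normc_mul ih.
Qed.

Lemma normc_eq0 z : (nc z == 0) = (z == 0).
Proof. by apply/eqP/eqP => [/Normc.eq0_normc//|->]; exact: Normc.normc0. Qed.

Lemma normc_gt0 z : (0 < nc z) = (z != 0).
Proof. by rewrite lt_def normc_ge0 andbT normc_eq0. Qed.

Lemma Re_le_normc z : `|complex.Re z| <= nc z.
Proof.
by case: z => a b; rewrite -sqrtr_sqr /= ler_wsqrtr// lerDl sqr_ge0.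
Qed.

Lemma Im_le_normc z : `|complex.Im z| <= nc z.
Proof.
by case: z => a b; rewrite -sqrtr_sqr /= ler_wsqrtr// lerDr sqr_ge0.
Qed.

Lemma normc_le_ReIm z : nc z <= `|complex.Re z| + `|complex.Im z|.
Proof.
rewrite -(@ler_pXn2r _ 2)// ?nnegrE ?addr_ge0 ?normc_ge0//.
rewrite normc_sqr sqrrD -!normrX !(@ger0_norm _ (_ ^+ 2)) ?sqr_ge0//.
by have : 0 <= `|complex.Re z| * `|complex.Im z| by []; lra.
Qed.

Lemma ler_normc_sum (I : Type) (r : seq I) (P : pred I) (F : I -> Cplx R) :
  nc (\sum_(i <- r | P i) F i) <= \sum_(i <- r | P i) nc (F i).
Proof.
elim/big_ind2 : _ => //; first by rewrite Normc.normc0.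
by move=> a b c d ab cd; exact: le_trans (ler_normcD _ _) (lerD _ _).
Qed.

Lemma lerB_normcD z w : nc z - nc w <= nc (z + w).
Proof.
by rewrite lerBlDr -{1}(addrK w z) (le_trans (ler_normcD _ _))// normc_opp.
Qed.

Lemma ltcR0 (e : R[i]) : 0 < e -> exists2 d : R, 0 < d & e = d%:C%C.
Proof.
move=> e0; exists (complex.Re e).
  by move: e0; rewrite ltcE => /andP[].
by rewrite RRe_real// gtr0_real.
Qed.

Lemma nbhs_normcP z (P : set (Cplx R)) :
  nbhs z P <-> exists2 d : R, 0 < d & forall w, nc (w - z) < d -> P w.
Proof.
split => [/nbhs_ballP[e /= /ltcR0[d d0 ->] dP]|[d d0 dP]].
  exists d => // w wd; apply: dP; rewrite /ball/= norm_normc ltcR.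
  by rewrite normcB.
apply/nbhs_ballP; exists d%:C%C; rewrite /= ?ltcR// => w.
by rewrite /ball/= norm_normc ltcR normcB; exact: dP.
Qed.

Lemma cvg_normcP (f : Cplx R -> Cplx R) z : {for z, continuous f} <->
  forall e : R, 0 < e -> exists2 d : R, 0 < d &
    forall w, nc (w - z) < d -> nc (f w - f z) < e.
Proof.
split.
- move=> cf e e0.
  have [|d d0 dP] := (nbhs_normcP z (fun w => nc (f w - f z) < e)).1.
    have : nbhs (f z) [set w | nc (w - f z) < e].
      by apply/nbhs_normcP; exists e.
    by move/cf.
  by exists d.
- move=> cf A /nbhs_normcP[e e0 eA].
  have [d d0 dP] := cf e e0.
  by apply/nbhs_normcP; exists d => // w /dP /eA.
Qed.

(** Complex differentiability at a point with an explicit derivative, with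
    moduli taken in the real field so that all estimates stay real. *)
Definition cdiff (f : Cplx R -> Cplx R) z (d : Cplx R) :=
  forall e : R, 0 < e -> exists2 a : R, 0 < a &
    forall w, nc (w - z) < a -> nc (f w - f z - d * (w - z)) <= e * nc (w - z).

Lemma cdiffP f z d : is_derive z (1 : Cplx R) f d <-> cdiff f z d.
Proof.
have dnE h : h != 0 -> h^-1 *: (f (h *: (1 : Cplx R) + z) - f z) - d =
    h^-1 * (f (h + z) - f z - d * h).
  move=> h0; rewrite mulrBr mulrCA mulVf// mulr1.
  by congr (_ * (f (_ + _) - _) - _); rewrite /GRing.scale/= mulr1.
split=> [df e e0|df].
- have df1 : (fun h => h^-1 *: (f (h *: (1 : Cplx R) + z) - f z)) @ (0 : Cplx R)^' --> d.
    by case: df => df1 <-; exact: df1.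
  have : nbhs d [set w | nc (w - d) <= e].
    by apply/nbhs_normcP; exists e => // w /ltW.
  move/df1; rewrite /nbhs/= /dnbhs/= /within/= => /(@nbhs_normcP 0)[a a0 aP].
  exists a => // w wa.
  have [->|wz] := eqVneq w z; first by rewrite !subrr mulr0 subrr Normc.normc0 mulr0.
  have wz0 : w - z != 0 by rewrite subr_eq0.
  have := aP (w - z); rewrite subr0 => /(_ wa wz0).
  rewrite dnE// subrK normc_mul normc_inv ler_pdivrMl ?normc_gt0//.
  by rewrite [e * _]mulrC.
- have df1 : (fun h => h^-1 *: (f (h *: (1 : Cplx R) + z) - f z)) @ (0 : Cplx R)^' --> d.
    move=> A /nbhs_normcP[e e0 eA].
    have [a a0 aP] := df (e / 2) (divr_gt0 e0 (ltr0Sn _ _)).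
    rewrite /nbhs/= /dnbhs/= /within/=; apply/(@nbhs_normcP 0); exists a => // h.
    rewrite subr0 => ha h0; apply: eA; rewrite dnE//.
    have := aP (h + z); rewrite addrK => /(_ ha) hh.
    rewrite normc_mul normc_inv ltr_pdivrMl ?normc_gt0//.
    rewrite (le_lt_trans hh)// [_ * e]mulrC ltr_pM2r ?normc_gt0//.
    by rewrite ltr_pdivrMr// ltr_pMr// ltr1n.
  by apply: DeriveDef; [apply/cvg_ex; exists d|exact: cvg_lim df1].
Qed.

Lemma cdiff_continuous f z d : cdiff f z d -> {for z, continuous f}.
Proof.
move=> df; apply/cvg_normcP => e e0.
have [a a0 aP] := df 1 ltr01.
have K0 : 0 < 1 + nc d by rewrite ltr_pwDl// normc_ge0.
exists (Num.min a (e / (1 + nc d))).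
  by rewrite lt_min a0 divr_gt0.
move=> w; rewrite lt_min => /andP[/aP wa].
rewrite ltr_pdivlMr// => we; apply: le_lt_trans we.
rewrite -{1}(subrK (d * (w - z)) (f w - f z)) (le_trans (ler_normcD _ _))//.
by move: wa; rewrite normc_mul; lra.
Qed.

Lemma continuous_Cplx_id z : {for z, continuous (fun z : Cplx R => z)}.
Proof. exact: cvg_id. Qed.

Lemma continuous_Cplx_cst z (c : Cplx R) : {for z, continuous (fun _ : Cplx R => c)}.
Proof. exact: (@cst_continuous (Cplx R) (Cplx R) c z). Qed.

Lemma continuous_CplxD (f g : Cplx R -> Cplx R) z : {for z, continuous f} ->
  {for z, continuous g} -> {for z, continuous (fun z => f z + g z)}.
Proof.
by move=> cf cg; exact: (@cvgD R[i] (Cplx R) (Cplx R) (nbhs z) _ f g _ _ cf cg).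
Qed.

Lemma continuous_CplxB (f g : Cplx R -> Cplx R) z : {for z, continuous f} ->
  {for z, continuous g} -> {for z, continuous (fun z => f z - g z)}.
Proof.
by move=> cf cg; exact: (@cvgB R[i] (Cplx R) (Cplx R) (nbhs z) _ f g _ _ cf cg).
Qed.

Lemma continuous_CplxM (f g : Cplx R -> Cplx R) z : {for z, continuous f} ->
  {for z, continuous g} -> {for z, continuous (fun z => f z * g z)}.
Proof.
by move=> cf cg; exact: (@cvgM R[i] (Cplx R) (nbhs z) _ f g _ _ cf cg).
Qed.

Lemma continuous_CplxV (f : Cplx R -> Cplx R) z : f z != 0 ->
  {for z, continuous f} -> {for z, continuous (fun z => (f z)^-1)}.
Proof.
by move=> fz cf; exact: (@cvgV R[i] (Cplx R) (nbhs z) _ f _ fz cf).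
Qed.

Lemma continuous_CplxX (f : Cplx R -> Cplx R) z n :
  {for z, continuous f} -> {for z, continuous (fun z => f z ^+ n)}.
Proof.
move=> cf; elim: n => [|n ih].
  have -> : (fun z => f z ^+ 0) = (fun=> 1 : Cplx R).
    by apply/funext => w; exact: expr0.
  exact: continuous_Cplx_cst.
have -> : (fun z => f z ^+ n.+1) = (fun z => f z * f z ^+ n).
  by apply/funext => w; exact: exprS.
exact: continuous_CplxM.
Qed.

(** Caratheodory's form of differentiability: the difference quotient extends
    continuously to the base point. The rules of calculus become algebra, and
    Cauchy's formula comes from the mean value property of a multiple of the
    extended quotient. *)
Lemma cdiff_slope f z d : cdiff f z d <-> exists q : Cplx R -> Cplx R,
  [/\ {for z, continuous q}, q z = d & forall w, f w = f z + q w * (w - z)].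
Proof.
split=> [df|[q [/cvg_normcP cq qz fq]] e e0]; last first.
  have [a a0 aP] := cq e e0; exists a => // w /aP /ltW wa.
  have -> : f w - f z = q w * (w - z) by rewrite fq addrAC subrr add0r.
  by rewrite -mulrBl normc_mul ler_wpM2r ?normc_ge0// -qz.
pose q w := if w == z then d else (f w - f z) / (w - z).
exists q; split; last 2 first.
- by rewrite /q eqxx.
- move=> w; rewrite /q; case: eqVneq => [->|wz]; first by rewrite subrr mulr0 addr0.
  by rewrite divfK ?subr_eq0// addrC subrK.
apply/cvg_normcP => e e0.
have [a a0 aP] := df (e / 2) ltac:(by rewrite divr_gt0).
exists a => // w /aP wa; rewrite /q eqxx; case: eqVneq wa => [->|wz] wa.
  by rewrite subrr Normc.normc0.
have wz0 : w - z != 0 by rewrite subr_eq0.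
have -> : (f w - f z) / (w - z) - d = (f w - f z - d * (w - z)) / (w - z).
  by rewrite [RHS]mulrBl mulfK.
rewrite normc_mul normc_inv ltr_pdivrMr ?normc_gt0//; apply: le_lt_trans wa _.
by rewrite ltr_pM2r ?normc_gt0// ltr_pdivrMr// ltr_pMr// ltr1n.
Qed.

Lemma cdiff_cst z c : cdiff (fun=> c) z 0.
Proof.
apply/cdiff_slope; exists (fun=> 0); split=> //; first exact: continuous_Cplx_cst.
by move=> w; rewrite mul0r addr0.
Qed.

Lemma cdiff_id z : cdiff (fun w => w) z 1.
Proof.
apply/cdiff_slope; exists (fun=> 1); split=> //; first exact: continuous_Cplx_cst.
by move=> w; rewrite mul1r addrC subrK.
Qed.

Lemma cdiffB f g z a b : cdiff f z a -> cdiff g z b ->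
  cdiff (fun w => f w - g w) z (a - b).
Proof.
move=> /cdiff_slope[p [cp <- fp]] /cdiff_slope[q [cq <- gq]].
apply/cdiff_slope; exists (fun w => p w - q w); split=> [||w].
- exact: continuous_CplxB.
- by [].
- by rewrite [in LHS]fp [in LHS]gq mulrBl opprD addrACA.
Qed.

Lemma cdiffM f g z a b : cdiff f z a -> cdiff g z b ->
  cdiff (fun w => f w * g w) z (a * g z + f z * b).
Proof.
move=> df /[dup] dg /cdiff_slope[q [cq <- gq]].
have /cdiff_slope[p [cp <- fp]] := df.
apply/cdiff_slope; exists (fun w => p w * g w + f z * q w); split=> [||w].
- apply: continuous_CplxD; apply: continuous_CplxM;
    [exact: cp| |exact: continuous_Cplx_cst|exact: cq].
  exact: cdiff_continuous dg.
- by [].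
- have fE : f w - f z = p w * (w - z) by rewrite fp addrAC subrr add0r.
  have gE : g w - g z = q w * (w - z) by rewrite gq addrAC subrr add0r.
  rewrite mulrDl [p w * g w * _]mulrAC -[f z * q w * _]mulrA -fE -gE.
  by rewrite mulrBl mulrBr subrKA addrC subrK.
Qed.

Lemma cdiff_near f g z d r : 0 < r ->
  (forall w, nc (w - z) < r -> g w = f w) -> cdiff f z d -> cdiff g z d.
Proof.
move=> r0 gf df e /df[a a0 aP]; exists (Num.min a r); first by rewrite lt_min a0.
move=> w; rewrite lt_min => /andP[/aP wa wr].
by rewrite !gf// subrr Normc.normc0.
Qed.

Lemma cdiffV f z a : cdiff f z a -> f z != 0 ->
  cdiff (fun w => (f w)^-1) z (- a / (f z * f z)).
Proof.
move=> df fz0; have cf := cdiff_continuous df.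
have [p [cp pa fp]] := (cdiff_slope _ _ _).1 df.
have fz1 : 0 < nc (f z) by rewrite normc_gt0.
have [r r0 rP] := (cvg_normcP _ _).1 cf _ fz1.
have fw0 w : nc (w - z) < r -> f w != 0.
  by move=> /rP; apply: contraTneq => ->; rewrite sub0r normc_opp ltxx.
pose q w := - p w / (f w * f z).
apply: (@cdiff_near (fun w => (f z)^-1 + q w * (w - z)) _ _ _ r) => //.
  move=> w /fw0 w0; have : f w - f z = p w * (w - z).
    by rewrite fp addrAC subrr add0r.
  rewrite /q mulrAC mulNr => <-.
  by field; rewrite fz0 w0.
apply/cdiff_slope; exists q; split.
- apply: continuous_CplxM.
    have -> : (fun w => - p w) = (fun w => -1 * p w).
      by apply/funext => w; rewrite mulN1r.
    by apply: continuous_CplxM; [exact: continuous_Cplx_cst|exact: cp].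
  apply: continuous_CplxV; first by rewrite mulf_neq0.
  by apply: continuous_CplxM; [exact: cf|exact: continuous_Cplx_cst].
- by rewrite /q pa.
- by move=> w; rewrite subrr mulr0 addr0.
Qed.

End Basics.

(** * Integrals over segments and Goursat's lemma for closed forms *)

Definition itg (R : realType) (a b : R) (g : R -> R) : R :=
  \int[@lebesgue_measure R]_(x in `[a, b]) g x.

Definition itgable (R : realType) (a b : R) (g : R -> R) :=
  (@lebesgue_measure R).-integrable `[a, b] (EFin \o g).

Section SegmentIntegral.
Context {R : realType}.
Implicit Types (a b c : R) (g : R -> R).

Lemma itgable_continuous a b g :
  {in `[a, b], continuous g} -> itgable a b g.
Proof.
move=> cg; apply: continuous_compact_integrable; first exact: segment_compact.
by apply: continuous_in_subspaceT => x /set_mem; exact: cg.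
Qed.

Lemma itgableB a b g h : itgable a b g -> itgable a b h ->
  itgable a b (fun x => g x - h x).
Proof. by move=> ig ih; apply: integrableB ig ih => //. Qed.

Lemma itg_split a c b g : a <= c -> c <= b -> itgable a b g ->
  itg a b g = itg a c g + itg c b g.
Proof.
move=> ac cb ig; have := @Rintegral_itvB R g (BLeft a) (BRight b) c ig.
rewrite !bnd_simp => /(_ ac cb) /eqP.
rewrite subr_eq addrC => /eqP; rewrite /itg => ->; congr (_ + _).
rewrite Rintegral_itv_obnd_cbnd//.
by apply: integrableS ig => //; apply: subset_itv; rewrite bnd_simp.
Qed.

Lemma itgB a b g h : itgable a b g -> itgable a b h ->
  itg a b (fun x => g x - h x) = itg a b g - itg a b h.
Proof. by move=> ig ih; rewrite /itg RintegralB. Qed.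

Lemma itgD a b g h : itgable a b g -> itgable a b h ->
  itg a b (fun x => g x + h x) = itg a b g + itg a b h.
Proof. by move=> ig ih; rewrite /itg RintegralD. Qed.

Lemma itgZ a b g k : itgable a b g ->
  itg a b (fun x => k * g x) = k * itg a b g.
Proof. by move=> ig; rewrite /itg RintegralZl. Qed.

Lemma itgableZ a b g k : itgable a b g -> itgable a b (fun x => k * g x).
Proof. by move=> ig; apply: integrableZl ig => //. Qed.

Lemma itgableD a b g h : itgable a b g -> itgable a b h ->
  itgable a b (fun x => g x + h x).
Proof. by move=> ig ih; apply: integrableD ig ih => //. Qed.

Lemma itgable_cst a b k : itgable a b (cst k).
Proof. by apply: itgable_continuous => x _; exact: cst_continuous. Qed.

Lemma itg_cst a b k : a <= b -> itg a b (fun=> k) = k * (b - a).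
Proof.
move=> ab; rewrite /itg Rintegral_cst//= lebesgue_measure_itv/= lte_fin.
by case: ltgtP ab => //= -> _; rewrite subrr.
Qed.

Lemma eq_itg a b g h : (forall x, a <= x <= b -> g x = h x) ->
  itg a b g = itg a b h.
Proof.
move=> gh; apply: eq_Rintegral => x; rewrite inE/= in_itv/=; exact: gh.
Qed.

Lemma ler_itg a b g h : itgable a b g -> itgable a b h ->
  (forall x, a <= x <= b -> g x <= h x) -> itg a b g <= itg a b h.
Proof.
move=> ig ih gh; apply: le_Rintegral => // x; rewrite /= in_itv/=; exact: gh.
Qed.

Lemma itg_near_cst a b g k K : a <= b -> itgable a b g ->
  (forall x, a <= x <= b -> `|g x - k| <= K) ->
  `|itg a b g - k * (b - a)| <= K * (b - a).
Proof.
move=> ab ig gK.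
have lo : itg a b (fun=> k - K) <= itg a b g.
  apply: ler_itg => // [|x /gK]; first exact: itgable_cst.
  by rewrite ler_distl => /andP[].
have hi : itg a b g <= itg a b (fun=> k + K).
  apply: ler_itg => // [|x /gK]; first exact: itgable_cst.
  by rewrite ler_distl => /andP[].
by move: lo hi; rewrite !itg_cst// ler_norml; lra.
Qed.

End SegmentIntegral.

Section Bisection.
Context {R : realType}.

Lemma halving_small (s r : R) : 0 < r -> exists n, s / 2 ^+ n < r.
Proof.
move=> r0; have [n sn] : exists n, s / r < n%:R.
  by exists (Num.truncn (s / r)).+1; exact: truncnS_gt.
exists n; rewrite ltr_pdivrMr ?exprn_gt0// mulrC -ltr_pdivrMr//.
apply: lt_trans sn _; rewrite -natrX ltr_nat; exact: ltn_expl.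
Qed.

(** The common point is the supremum of the left ends. *)
Lemma nested_halving (u : nat -> R) (L : R) :
  (forall n, u n <= u n.+1 /\ u n.+1 + L / 2 ^+ n.+1 <= u n + L / 2 ^+ n) ->
  0 <= L -> exists x, forall n, u n <= x <= u n + L / 2 ^+ n.
Proof.
move=> uS L0.
have w0 n : 0 <= L / 2 ^+ n by rewrite divr_ge0// exprn_ge0.
have mono n m : u n <= u (n + m)%N /\ u (n + m)%N + L / 2 ^+ (n + m) <= u n + L / 2 ^+ n.
  elim: m => [|m [i1 i2]]; first by rewrite addn0.
  by rewrite addnS; have [j1 j2] := uS (n + m)%N; split; lra.
have cross n m : u m <= u n + L / 2 ^+ n.
  have [/subnKC <-|/ltnW/subnKC <-] := leqP m n.
    by have [h _] := mono m (n - m)%N; have := w0 (m + (n - m))%N; lra.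
  by have [_ h] := mono n (m - n)%N; have := w0 (n + (m - n))%N; lra.
have ne : range u !=set0 by exists (u 0%N); exists 0%N.
exists (sup (range u)) => n; apply/andP; split.
  apply: ub_le_sup; last by exists n.
  by exists (u 0%N + L / 2 ^+ 0) => _ [m _ <-].
by apply: ge_sup => // _ [m _ <-].
Qed.

End Bisection.

Definition first_order2 (R : realType) (g : R -> R -> R) (x y A B : R) :=
  forall e : R, 0 < e -> exists2 r : R, 0 < r &
    forall x' y', `|x' - x| < r -> `|y' - y| < r ->
      `|g x' y' - g x y - A * (x' - x) - B * (y' - y)|
        <= e * (`|x' - x| + `|y' - y|).

Section Goursat.
Context {R : realType}.
Variables P Q : R -> R -> R.
Implicit Types (a b c d x y : R).

(** The cross derivatives agree, both being [B]. Continuity of the derivatives is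
    deliberately absent: Goursat's lemma is about doing without it. *)
Definition closed_form_at x y := exists A B C : R,
  first_order2 P x y A B /\ first_order2 Q x y B C.

(** The integral of [P dx + Q dy] around the boundary of the rectangle, with
    opposite sides grouped together. *)
Definition circulation a b c d :=
  itg a b (fun x => P x c - P x d) + itg c d (fun y => Q b y - Q a y).

Lemma continuous_of_first_order (g : R -> R) x A :
  (exists2 r, 0 < r & forall x', `|x' - x| < r ->
     `|g x' - g x - A * (x' - x)| <= `|x' - x|) ->
  {for x, continuous g}.
Proof.
move=> [r r0 rP]; apply/cvgrPdist_lt => e e0.
have K0 : 0 < 1 + `|A| by rewrite ltr_pwDl.
near=> w.
have wr : `|w - x| < r by near: w; apply: cvgr_distC_lt.
have we : `|w - x| < e / (1 + `|A|).
  by near: w; apply: cvgr_distC_lt; rewrite // divr_gt0.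
move: we; rewrite ltr_pdivlMr// => we; rewrite distrC.
apply: le_lt_trans we; have := rP _ wr.
have := ler_normD (g w - g x - A * (w - x)) (A * (w - x)).
rewrite subrK normrM; lra.
Unshelve. all: by end_near. Qed.

Lemma closed_form_continuous x y : closed_form_at x y ->
  {for x, continuous (P ^~ y)} /\ {for y, continuous (Q x)}.
Proof.
move=> [A [B [C [/(_ 1 ltr01)[r r0 rP] /(_ 1 ltr01)[q q0 qP]]]]]; split.
- apply: (@continuous_of_first_order _ _ A); exists r => // x' xr.
  have := rP x' y xr; rewrite subrr normr0 => /(_ r0).
  by rewrite mulr0 subr0 addr0 mul1r.
- apply: (@continuous_of_first_order _ _ C); exists q => // y' yr.
  have := qP x y'; rewrite subrr normr0 => /(_ q0 yr).
  by rewrite mulr0 subr0 add0r mul1r.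
Qed.

Section Rectangle.
Variables a b c d : R.
Hypotheses (ab : a <= b) (cd : c <= d).
Hypothesis PQ : forall x y, a <= x <= b -> c <= y <= d -> closed_form_at x y.

Let iP a' b' y : a <= a' -> b' <= b -> c <= y <= d -> itgable a' b' (P ^~ y).
Proof.
move=> aa bb yd; apply: itgable_continuous => x; rewrite in_itv/= => xab.
apply: (closed_form_continuous _).1; apply: PQ => //; lra.
Qed.

Let iQ c' d' x : c <= c' -> d' <= d -> a <= x <= b -> itgable c' d' (Q x).
Proof.
move=> cc dd xb; apply: itgable_continuous => y; rewrite in_itv/= => ycd.
apply: (closed_form_continuous _).2; apply: PQ => //; lra.
Qed.

Lemma circulation_split a' m b' c' k d' :
  a <= a' <= m -> m <= b' <= b -> c <= c' <= k -> k <= d' <= d ->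
  circulation a' b' c' d' =
  (circulation a' m c' k + circulation m b' c' k) +
  (circulation a' m k d' + circulation m b' k d').
Proof.
move=> am mb ck kd; rewrite /circulation !itgB; try (apply: iP; lra);
  try (apply: iQ; lra).
rewrite (@itg_split _ a' m b' (P ^~ c')); [|lra|lra|apply: iP; lra].
rewrite (@itg_split _ a' m b' (P ^~ d')); [|lra|lra|apply: iP; lra].
rewrite (@itg_split _ c' k d' (Q a')); [|lra|lra|apply: iQ; lra].
rewrite (@itg_split _ c' k d' (Q b')); [|lra|lra|apply: iQ; lra].
ring.
Qed.

(** The first order parts of the four sides cancel because the two cross
    derivatives agree, so only the remainders contribute. *)
Lemma circulation_local x y e : a <= x <= b -> c <= y <= d -> 0 < e ->
  exists2 r, 0 < r & forall a' b' c' d',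
    a <= a' <= x -> x <= b' <= b -> c <= c' <= y -> y <= d' <= d ->
    (b' - a') + (d' - c') < r ->
    `|circulation a' b' c' d'| <= e * ((b' - a') + (d' - c')) ^+ 2.
Proof.
move=> xab ycd e0; have [A [B [C PQxy]]] := PQ xab ycd.
have [Pxy Qxy] := PQxy.
have e40 : 0 < e / 4 by rewrite divr_gt0.
have [r1 r10 rP] := Pxy _ e40; have [r2 r20 rQ] := Qxy _ e40.
exists (Num.min r1 r2); first by rewrite lt_min r10.
move=> a' b' c' d' ax xb cy yd; rewrite lt_min => /andP[small1 small2].
have [aa bb ab'] : [/\ a <= a', b' <= b & a' <= b'] by split; lra.
have [cc dd cd'] : [/\ c <= c', d' <= d & c' <= d'] by split; lra.
have [ha hb] : a <= a' <= b /\ a <= b' <= b by split; lra.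
have [hc hd] : c <= c' <= d /\ c <= d' <= d by split; lra.
have nx x' : a' <= x' <= b' -> `|x' - x| <= b' - a'.
  by move=> h; rewrite ler_norml; lra.
have ny y' : c' <= y' <= d' -> `|y' - y| <= d' - c'.
  by move=> h; rewrite ler_norml; lra.
set s := _ + _ in small1 small2 *.
have est x' y' : a' <= x' <= b' -> c' <= y' <= d' ->
    `|P x' y' - P x y - A * (x' - x) - B * (y' - y)| <= e / 4 * s /\
    `|Q x' y' - Q x y - B * (x' - x) - C * (y' - y)| <= e / 4 * s.
  move=> /nx hx /ny hy.
  have h1 := rP x' y' (ltac:(rewrite /s in small1; lra)) (ltac:(rewrite /s in small1; lra)).
  have h2 := rQ x' y' (ltac:(rewrite /s in small2; lra)) (ltac:(rewrite /s in small2; lra)).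
  have h : e / 4 * (`|x' - x| + `|y' - y|) <= e / 4 * s.
    by rewrite ler_pM2l ?divr_gt0// lerD.
  by split; [exact: le_trans h1 h|exact: le_trans h2 h].
have h1 : `|itg a' b' (fun x' => P x' c' - P x' d') -
             (- B * (d' - c')) * (b' - a')| <= (e / 2 * s) * (b' - a').
  apply: itg_near_cst => //; first by apply: itgableB; apply: iP.
  move=> x' hx.
  have [|e1 _] := est x' c' hx; first by rewrite lexx.
  have [|e2 _] := est x' d' hx; first by rewrite lexx andbT.
  move: e1 e2; rewrite !ler_norml; lra.
have h2 : `|itg c' d' (fun y' => Q b' y' - Q a' y') -
             (B * (b' - a')) * (d' - c')| <= (e / 2 * s) * (d' - c').
  apply: itg_near_cst => //; first by apply: itgableB; apply: iQ.
  move=> y' hy.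
  have [|_ e1] := est b' y' _ hy; first by rewrite lexx andbT.
  have [|_ e2] := est a' y' _ hy; first by rewrite lexx.
  move: e1 e2; rewrite !ler_norml; lra.
have h3 : (e / 2 * s) * (b' - a') + (e / 2 * s) * (d' - c') = e / 2 * s ^+ 2.
  by rewrite /s; ring.
rewrite /circulation; have := sqr_ge0 s; have : 0 <= e * s ^+ 2.
  by rewrite mulr_ge0 ?sqr_ge0// ltW.
by move: h1 h2 h3; rewrite !ler_norml; lra.
Qed.

(** Otherwise some quarter of the rectangle violates the scaled bound, hence a
    quarter of that quarter, and so on; the bound would then fail on arbitrarily
    small rectangles around the limit point, against [circulation_local]. *)
Lemma circulation_small e : 0 < e ->
  `|circulation a b c d| <= e * ((b - a) + (d - c)) ^+ 2.
Proof.
move=> e0; rewrite leNgt; apply/negP => bad0.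
pose w n := (b - a) / 2 ^+ n; pose v n := (d - c) / 2 ^+ n.
have half (L : R) n : L / 2 ^+ n.+1 = L / 2 ^+ n / 2.
  by rewrite exprSr invfM mulrA.
have w0 n : 0 <= w n by rewrite divr_ge0 ?exprn_ge0 ?subr_ge0.
have v0 n : 0 <= v n by rewrite divr_ge0 ?exprn_ge0 ?subr_ge0.
pose bad n (u : R * R) := [/\ a <= u.1, u.1 + w n <= b, c <= u.2,
  u.2 + v n <= d & e * (w n + v n) ^+ 2 <
    `|circulation u.1 (u.1 + w n) u.2 (u.2 + v n)|].
have step (nu : nat * (R * R)) : exists u', bad nu.1 nu.2 ->
    [/\ bad nu.1.+1 u', nu.2.1 <= u'.1,
      u'.1 + w nu.1.+1 <= nu.2.1 + w nu.1, nu.2.2 <= u'.2 &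
      u'.2 + v nu.1.+1 <= nu.2.2 + v nu.1].
  case: nu => n [x y] /=; apply: contrapT => /forallNP none.
  have [au ub cu ud] : bad n (x, y) by apply: contrapT => nb; apply: (none (0, 0)).
  have wS : w n.+1 = w n / 2 by exact: half.
  have vS : v n.+1 = v n / 2 by exact: half.
  have := w0 n; have := v0 n => vn0 wn0 /=.
  have small x' y' : x <= x' -> x' + w n / 2 <= x + w n -> y <= y' ->
      y' + v n / 2 <= y + v n ->
      `|circulation x' (x' + w n / 2) y' (y' + v n / 2)| <=
      e * (w n + v n) ^+ 2 / 4.
    move=> h1 h2 h3 h4; rewrite leNgt; apply/negP => h5.
    apply: (none (x', y')) => _; split; rewrite /= ?wS ?vS //.
    move: au ub cu ud => /= au ub cu ud.
    split; rewrite /= ?wS ?vS; [lra..|].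
    rewrite (_ : e * _ = e * (w n + v n) ^+ 2 / 4)//; by field.
  move: au ub cu ud => /= au ub cu ud.
  rewrite (@circulation_split _ (x + w n / 2) _ _ (y + v n / 2)); try lra.
  have xE : x + w n / 2 + w n / 2 = x + w n by field.
  have yE : y + v n / 2 + v n / 2 = y + v n by field.
  have x1 : x <= x + w n / 2 by rewrite lerDl divr_ge0.
  have x2 : x + w n / 2 <= x + w n by rewrite -xE lerDl divr_ge0.
  have y1 : y <= y + v n / 2 by rewrite lerDl divr_ge0.
  have y2 : y + v n / 2 <= y + v n by rewrite -yE lerDl divr_ge0.
  have s1 := small x y (lexx _) x2 (lexx _) y2.
  have s2 := small (x + w n / 2) y x1 _ (lexx _) y2.
  have s3 := small x (y + v n / 2) (lexx _) x2 y1.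
  have s4 := small (x + w n / 2) (y + v n / 2) x1 _ y1.
  rewrite xE in s2 s4; rewrite yE in s3 s4.
  have {}s2 := s2 (lexx _); have {}s3 := s3 (lexx _).
  have {}s4 := s4 (lexx _) (lexx _).
  apply/negP; rewrite -leNgt {small none}.
  by move: s1 s2 s3 s4; rewrite !ler_norml; lra.
have [F FP] := choice step.
pose U := fix U n := if n is m.+1 then F (m, U m) else (a, c).
have Ubad n : bad n (U n).
  elim: n => [|n /(FP (n, U n))[]//].
  rewrite /bad /= /w /v expr0 !divr1; split; try lra.
  by rewrite (addrC a) subrK (addrC c) subrK.
have UF n : [/\ (U n).1 <= (U n.+1).1, (U n.+1).1 + w n.+1 <= (U n).1 + w n,
    (U n).2 <= (U n.+1).2 & (U n.+1).2 + v n.+1 <= (U n).2 + v n].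
  by have [_ ? ? ? ?] := FP (n, U n) (Ubad n).
have [||x xP] := @nested_halving R (fun n => (U n).1) (b - a).
- by move=> n; have [] := UF n.
- by rewrite subr_ge0.
have [||y yP] := @nested_halving R (fun n => (U n).2) (d - c).
- by move=> n; have [] := UF n.
- by rewrite subr_ge0.
have xab : a <= x <= b.
  by have := xP 0%N; rewrite /= expr0 divr1; lra.
have ycd : c <= y <= d.
  by have := yP 0%N; rewrite /= expr0 divr1; lra.
have [r r0 rP] := circulation_local xab ycd e0.
have [n] := halving_small ((b - a) + (d - c)) r0.
rewrite mulrDl -/(w n) -/(v n) => nr.
have [h1 h2 h3 h4] := Ubad n; apply/negP; rewrite -leNgt.
have := xP n; have := yP n; rewrite -/(w n) -/(v n) => ynP xnP.
have := rP (U n).1 ((U n).1 + w n) (U n).2 ((U n).2 + v n).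
rewrite !(addrC (U n).1) !(addrC (U n).2) !addrK; apply; lra.
Qed.

Lemma goursat_rectangle : circulation a b c d = 0.
Proof.
apply/eqP; rewrite -normr_eq0 eq_le normr_ge0 andbT.
apply/ler_addgt0Pl => e e0; rewrite addr0.
set s := (b - a) + (d - c); have s1 : 0 < s ^+ 2 + 1 by rewrite ltr_wpDl ?sqr_ge0.
have := circulation_small (divr_gt0 e0 s1); rewrite -/s => /le_trans; apply.
rewrite mulrAC ler_pdivrMr// ler_pM2l//; lra.
Qed.
End Rectangle.
End Goursat.

(** * Polar coordinates and integrals over circles *)

Section FirstOrder.
Context {R : realType}.
Implicit Types (x y t e : R).

Lemma is_derive_first_order (g : R -> R) x D : is_derive x 1 g D ->
  forall e, 0 < e -> exists2 r, 0 < r & forall x', `|x' - x| < r ->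
    `|g x' - g x - D * (x' - x)| <= e * `|x' - x|.
Proof.
move=> dg e e0.
have dg1 : (fun h => h^-1 *: (g (h *: 1 + x) - g x)) @ (0 : R)^' --> D.
  by case: dg => dg1 <-; exact: dg1.
have : nbhs D [set w | `|w - D| <= e].
  by apply/nbhs_ballP; exists e => // w /=; rewrite /ball/= distrC => /ltW.
move/dg1; rewrite /nbhs/= /dnbhs/= /within/= => /nbhs_ballP[r /= r0 rP].
exists r => // w wr.
have [->|wx] := eqVneq w x; first by rewrite !subrr mulr0 subrr normr0 mulr0.
have wx0 : w - x != 0 by rewrite subr_eq0.
have := rP (w - x); rewrite /ball/= sub0r normrN => /(_ wr wx0).
rewrite [(w - x) *: 1]mulr1 subrK.
have -> : (w - x)^-1 *: (g w - g x) - D = (w - x)^-1 * (g w - g x - D * (w - x)).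
  by rewrite mulrBr [_ * (D * _)]mulrCA mulVf// mulr1.
by rewrite normrM normfV ler_pdivrMl ?normr_gt0// [e * _]mulrC.
Qed.

Lemma first_order2M (u v : R -> R) x y du dv :
  is_derive x 1 u du -> is_derive y 1 v dv ->
  first_order2 (fun x y => u x * v y) x y (du * v y) (u x * dv).
Proof.
move=> hu hv e e0.
pose K := `|u x| + `|v y| + (`|du| + 1) * (`|dv| + 1).
have K0 : 0 < K by rewrite ltr_wpDl ?addr_ge0// mulr_gt0// ltr_wpDl.
pose e' := Num.min 1 (e / K).
have e'0 : 0 < e' by rewrite lt_min ltr01 divr_gt0.
have e'1 : e' <= 1 by rewrite ge_min lexx.
have e'K : e' * K <= e by rewrite -ler_pdivlMr// ge_min lexx orbT.
clearbody e'.
have [r1 r10 uP] := is_derive_first_order hu e'0.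
have [r2 r20 vP] := is_derive_first_order hv e'0.
exists (Num.min e' (Num.min r1 r2)); first by rewrite !lt_min e'0 r10.
move=> x' y'; rewrite !lt_min => /and3P[xe x1 _] /and3P[ye _ y2].
have := uP _ x1; have := vP _ y2.
set du' := u x' - u x - _; set dv' := v y' - v y - _ => hv' hu'.
have -> : u x' * v y' - u x * v y - du * v y * (x' - x) - u x * dv * (y' - y) =
  u x * dv' + v y * du' + (du * (x' - x) + du') * (dv * (y' - y) + dv').
  by rewrite /du' /dv'; ring.
set a := `|x' - x| in xe hu' *; set b := `|y' - y| in ye hv' *.
have a0 : 0 <= a by exact: normr_ge0.
have b0 : 0 <= b by exact: normr_ge0.
have h1 : `|u x * dv'| <= e' * `|u x| * b.
  by rewrite normrM [e' * _]mulrC -mulrA ler_wpM2l.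
have h2 : `|v y * du'| <= e' * `|v y| * a.
  by rewrite normrM [e' * _]mulrC -mulrA ler_wpM2l.
have h3 : `|du * (x' - x) + du'| <= (`|du| + 1) * a.
  rewrite (le_trans (ler_normD _ _))// normrM mulrDl mul1r lerD2l.
  by rewrite (le_trans hu')// ler_piMl.
have h4 : `|dv * (y' - y) + dv'| <= (`|dv| + 1) * e'.
  rewrite (le_trans (ler_normD _ _))// normrM mulrDl mul1r lerD//.
    by rewrite ler_wpM2l// ltW.
  by rewrite (le_trans hv')// ger_pMr// ltW// (lt_le_trans ye).
have h5 : `|(du * (x' - x) + du') * (dv * (y' - y) + dv')| <=
    ((`|du| + 1) * a) * ((`|dv| + 1) * e').
  by rewrite normrM ler_pM.
apply: (@le_trans _ _ (e' * K * (a + b))); last first.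
  by rewrite ler_wpM2r// addr_ge0.
rewrite (le_trans (ler_normD _ _))//.
rewrite (le_trans (lerD (ler_normD _ _) (lexx _)))//.
have -> : e' * K * (a + b) = e' * `|u x| * b + e' * `|v y| * a
   + (`|du| + 1) * a * ((`|dv| + 1) * e')
   + (e' * `|u x| * a + e' * `|v y| * b + (`|du| + 1) * b * ((`|dv| + 1) * e')).
  by rewrite /K; ring.
rewrite -[leLHS]addr0 lerD// ?lerD//.
have du1 : 0 <= `|du| + 1 by rewrite addr_ge0.
have dv1 : 0 <= `|dv| + 1 by rewrite addr_ge0.
by rewrite !addr_ge0// !mulr_ge0// ltW.
Qed.

(** The chain rule: the differential of [f] at the point [X + i Y] is
    multiplication by [D], and each partial derivative of [X + i Y] is multiplied
    by it. *)
Lemma first_order2_comp (f : Cplx R -> Cplx R) (X Y : R -> R -> R) x y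
    (D : Cplx R) a1 b1 a2 b2 :
  first_order2 X x y a1 b1 -> first_order2 Y x y a2 b2 ->
  cdiff f (X x y +i* Y x y)%C D ->
  first_order2 (fun x y => complex.Re (f (X x y +i* Y x y)%C)) x y
    (complex.Re D * a1 - complex.Im D * a2)
    (complex.Re D * b1 - complex.Im D * b2) /\
  first_order2 (fun x y => complex.Im (f (X x y +i* Y x y)%C)) x y
    (complex.Re D * a2 + complex.Im D * a1)
    (complex.Re D * b2 + complex.Im D * b1).
Proof.
move=> hX hY hf.
pose M := `|a1| + `|b1| + 1 + (`|a2| + `|b2| + 1).
have M0 : 0 < M by rewrite addr_gt0// ltr_wpDl// addr_ge0.
pose N := `|complex.Re D| + `|complex.Im D| + 1.
have N0 : 0 < N by rewrite ltr_wpDl// addr_ge0.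
have key e : 0 < e -> exists2 r, 0 < r & forall x' y',
  `|x' - x| < r -> `|y' - y| < r ->
  [/\ `|X x' y' - X x y - a1 * (x' - x) - b1 * (y' - y)|
        <= e / 2 / N * (`|x' - x| + `|y' - y|),
      `|Y x' y' - Y x y - a2 * (x' - x) - b2 * (y' - y)|
        <= e / 2 / N * (`|x' - x| + `|y' - y|) &
      nc (f (X x' y' +i* Y x' y')%C - f (X x y +i* Y x y)%C -
         D * ((X x' y' - X x y) +i* (Y x' y' - Y x y))%C) <=
       e / 2 * (`|x' - x| + `|y' - y|)].
  move=> e0.
  have eN : 0 < Num.min 1 (e / 2 / N) by rewrite lt_min ltr01 !divr_gt0.
  have [r0 r00 fP] := hf (e / 2 / M) ltac:(by rewrite !divr_gt0).
  have [r1 r10 XP] := hX _ eN; have [r2 r20 YP] := hY _ eN.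
  exists (Num.min r1 (Num.min r2 (r0 / 2 / M))).
    by rewrite !lt_min r10 r20 !divr_gt0.
  move=> x' y'; rewrite !lt_min => /and3P[x1 x2 x3] /and3P[y1 y2 y3].
  have {}XP := XP _ _ x1 y1; have {}YP := YP _ _ x2 y2.
  set s := `|x' - x| + `|y' - y| in XP YP *.
  have s0 : 0 <= s by rewrite addr_ge0.
  have weaken a : a <= Num.min 1 (e / 2 / N) * s -> a <= s /\ a <= e / 2 / N * s.
    move=> h; split; apply: (le_trans h).
      by rewrite ler_piMl// ge_min lexx.
    by rewrite ler_wpM2r// ge_min lexx orbT.
  have [X1 X2] := weaken _ XP; have [Y1 Y2] := weaken _ YP.
  split => //.
  have bound (g a b : R) : `|g - a * (x' - x) - b * (y' - y)| <= s ->
      `|g| <= (`|a| + `|b| + 1) * s.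
    move=> h.
    have -> : g = (g - a * (x' - x) - b * (y' - y)) + (a * (x' - x) + b * (y' - y)).
      by ring.
    rewrite (le_trans (ler_normD _ _))//.
    have := ler_normD (a * (x' - x)) (b * (y' - y)); rewrite !normrM => h'.
    have : 0 <= `|a| * `|y' - y| + `|b| * `|x' - x| by [].
    move: h h'; rewrite /s; lra.
  have dM : nc ((X x' y' - X x y) +i* (Y x' y' - Y x y))%C <= M * s.
    rewrite (le_trans (normc_le_ReIm _))//= /M mulrDl lerD//; exact: bound.
  have zE : ((X x' y' - X x y) +i* (Y x' y' - Y x y))%C =
    (X x' y' +i* Y x' y')%C - (X x y +i* Y x y)%C by [].
  have := fP (X x' y' +i* Y x' y')%C; rewrite -zE.
  have -> : e / 2 * s = e / 2 / M * (M * s) by field; rewrite gt_eqF.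
  move=> h; apply: le_trans (h _) _.
    apply: le_lt_trans dM _.
    have : s < r0 / 2 / M + r0 / 2 / M by rewrite ltrD.
    by rewrite -mulrDl -splitr ltr_pdivlMr// mulrC.
  by rewrite ler_wpM2l// !divr_ge0// ltW.
have lin (c1 c2 u v s d : R) : `|c1| + `|c2| <= N -> 0 <= s -> 0 < d ->
    `|u| <= d / 2 / N * s -> `|v| <= d / 2 / N * s -> `|c1 * u + c2 * v| <= d / 2 * s.
  move=> cN s0 d0 hu hv; rewrite (le_trans (ler_normD _ _))// !normrM.
  apply: (@le_trans _ _ ((`|c1| + `|c2|) * (d / 2 / N * s))).
    by rewrite mulrDl lerD// ler_wpM2l.
  have -> : d / 2 * s = N * (d / 2 / N * s) by field; rewrite gt_eqF.
  by rewrite ler_wpM2r// mulr_ge0// !divr_ge0// ltW.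
split=> e e0; have [r r0 rP] := key e e0; exists r => // x' y' xr yr;
  have [hX' hY' hf'] := rP x' y' xr yr; set s := `|x' - x| + `|y' - y| in hX' hY' hf' *;
  have s0 : 0 <= s by rewrite addr_ge0.
- have l := lin (complex.Re D) (- complex.Im D) _ _ _ _ _ s0 e0 hX' hY'.
  have {}l := l ltac:(by rewrite normrN lerDl).
  have := le_trans (Re_le_normc _) hf'; move: l.
  case: D {hf N N0 key lin hX' hY' hf' rP} => d1 d2 /=.
  case: (f _) => p1 p2; case: (f _) => q1 q2 /=; rewrite !ler_norml; lra.
- have l := lin (complex.Im D) (complex.Re D) _ _ _ _ _ s0 e0 hX' hY'.
  have {}l := l ltac:(by rewrite [_ + `|complex.Re D|]addrC lerDl).
  have := le_trans (Im_le_normc _) hf'; move: l.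
  case: D {hf N N0 key lin hX' hY' hf' rP} => d1 d2 /=.
  case: (f _) => p1 p2; case: (f _) => q1 q2 /=; rewrite !ler_norml; lra.
Qed.

End FirstOrder.

Section CircleMean.
Context {R : realType}.
Implicit Types (f : Cplx R -> Cplx R) (z w : Cplx R) (r t x : R).
Local Notation pi2 := (2 * pi : R).

Lemma normc_circle_point r t : nc (circle_point r t) = `|r|.
Proof.
rewrite /= !exprMn -mulrDr cos2Dsin2 mulr1; exact: sqrtr_sqr.
Qed.

Lemma circle_point2pi r : circle_point r pi2 = circle_point r 0.
Proof.
by rewrite /circle_point mulr_natl cos2pi sin2pi cos0 sin0.
Qed.

Lemma circle_point0 t : circle_point 0 t = 0.
Proof. by rewrite /circle_point !mul0r. Qed.

(** In the coordinates [x = ln r] and [t], the differential [f(z) dz / z] is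
    [f (dx + i dt)], so its real part is closed wherever [f] is holomorphic. *)
Lemma closed_form_polar f x t D : cdiff f (circle_point (expR x) t) D ->
  closed_form_at (fun x t => complex.Im (f (circle_point (expR x) t)))
                 (fun x t => complex.Re (f (circle_point (expR x) t))) x t.
Proof.
move=> df.
have hX := first_order2M (is_derive_expR x) (is_derive_cos t).
have hY := first_order2M (is_derive_expR x) (is_derive_sin t).
have [hRe hIm] := first_order2_comp hX hY df.
exists (complex.Re D * (expR x * sin t) + complex.Im D * (expR x * cos t)).
exists (complex.Re D * (expR x * cos t) - complex.Im D * (expR x * sin t)).
exists (complex.Re D * (expR x * - sin t) - complex.Im D * (expR x * cos t)).
split => //.
have -> : complex.Re D * (expR x * cos t) - complex.Im D * (expR x * sin t) =
  complex.Re D * (expR x * cos t) + complex.Im D * (expR x * - sin t) by ring.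
exact: hIm.
Qed.

(** Goursat's lemma on the rectangle between [ln r1] and [ln r2] and between the
    angles [0] and [2 pi]: by periodicity its two radial sides contribute
    nothing, and what remains is the difference of the two integrals. *)
Lemma circle_integral_constant f r1 r2 : 0 < r1 -> r1 <= r2 ->
  (forall z, r1 <= nc z <= r2 -> exists D, cdiff f z D) ->
  itg 0 pi2 (fun t => complex.Re (f (circle_point r1 t))) =
  itg 0 pi2 (fun t => complex.Re (f (circle_point r2 t))).
Proof.
move=> r10 r12 df; have r20 : 0 < r2 by exact: lt_le_trans r12.
have l12 : ln r1 <= ln r2 by rewrite ler_ln.
have p0 : 0 <= pi2 by rewrite mulr_ge0// pi_ge0.
pose P x t := complex.Im (f (circle_point (expR x) t)).
pose Q x t := complex.Re (f (circle_point (expR x) t)).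
have PQ x t : ln r1 <= x <= ln r2 -> 0 <= t <= pi2 -> closed_form_at P Q x t.
  move=> /andP[x1 x2] _; have [|D dD] := df (circle_point (expR x) t).
    rewrite normc_circle_point gtr0_norm ?expR_gt0//.
    by apply/andP; split; rewrite -ler_ln ?posrE ?expR_gt0// expRK.
  exact: closed_form_polar dD.
have := goursat_rectangle l12 p0 PQ; rewrite /circulation.
rewrite (_ : itg _ _ (fun x => P x 0 - P x pi2) = 0); last first.
  rewrite (@eq_itg _ _ _ _ (fun=> 0)) ?itg_cst ?mul0r// => x _.
  by rewrite /P circle_point2pi subrr.
have iQ x : ln r1 <= x <= ln r2 -> itgable 0 pi2 (Q x).
  move=> hx; apply: itgable_continuous => t; rewrite in_itv/= => ht.
  exact: (closed_form_continuous (PQ _ _ hx ht)).2.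
rewrite itgB; [|by apply: iQ; rewrite l12 lexx..].
by rewrite add0r /Q !lnK// => /eqP; rewrite subr_eq0 => /eqP.
Qed.

Lemma cvg_Cplx (T : Type) (F : set_system T) (FF : Filter F) (g : T -> Cplx R) z :
  (complex.Re (g x) @[x --> F] --> complex.Re z) ->
  (complex.Im (g x) @[x --> F] --> complex.Im z) -> g @ F --> z.
Proof.
move=> hR hI A /nbhs_normcP[e e0 eA].
have e20 : 0 < e / 2 by rewrite divr_gt0.
move/cvgrPdist_lt: hR => /(_ _ e20) hR; move/cvgrPdist_lt: hI => /(_ _ e20) hI.
suff : \forall x \near F, A (g x) by [].
near=> x; apply: eA.
rewrite normcB (le_lt_trans (normc_le_ReIm _))// [e in ltRHS]splitr.
rewrite ltrD//.
  have : `|complex.Re z - complex.Re (g x)| < e / 2 by near: x.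
  by case: (z) (g x) => ? ? [].
have : `|complex.Im z - complex.Im (g x)| < e / 2 by near: x.
by case: (z) (g x) => ? ? [].
Unshelve. all: by end_near. Qed.

Lemma lipschitz1_continuous (g : Cplx R -> R) :
  (forall z w, `|g z - g w| <= nc (z - w)) -> continuous g.
Proof.
move=> gL z A /nbhs_ballP[e /= e0 eA]; apply/nbhs_normcP; exists e => // w we.
by apply: eA; rewrite /ball/= (le_lt_trans (gL _ _))// normcB.
Qed.

Lemma continuous_Re : continuous (@complex.Re R : Cplx R -> R).
Proof.
by apply: lipschitz1_continuous => -[a b] [c d]; exact: (Re_le_normc ((a - c) +i* (b - d))%C).
Qed.

Lemma continuous_Im : continuous (@complex.Im R : Cplx R -> R).
Proof.
by apply: lipschitz1_continuous => -[a b] [c d]; exact: (Im_le_normc ((a - c) +i* (b - d))%C).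
Qed.

Lemma continuous_normc : continuous (@Normc.normc R : Cplx R -> R).
Proof.
apply: lipschitz1_continuous => z w; rewrite ler_norml.
have := ler_normcD (z - w) w; have := ler_normcD (w - z) z.
by rewrite !subrK (normcB w z); lra.
Qed.

Lemma continuous_circle_point : continuous (fun p : R * R => circle_point p.1 p.2 : Cplx R).
Proof.
move=> [r t]; apply: cvg_Cplx => /=; apply: cvgM; try exact: cvg_fst.
- apply: (@continuous_comp _ _ _ snd cos (r, t)); first exact: cvg_snd.
  exact: continuous_cos.
- apply: (@continuous_comp _ _ _ snd sin (r, t)); first exact: cvg_snd.
  exact: continuous_sin.
Qed.

Lemma continuous_circle_angle r : continuous (circle_point r : R -> Cplx R).
Proof.
move=> t; apply: cvg_Cplx => /=; apply: cvgM; try exact: cvg_cst.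
- exact: continuous_cos.
- exact: continuous_sin.
Qed.

Lemma continuous_circle_radius t : continuous ((@circle_point R)^~ t : R -> Cplx R).
Proof.
by move=> r; apply: cvg_Cplx => /=; apply: cvgM;
  [exact: cvg_id|exact: cvg_cst|exact: cvg_id|exact: cvg_cst].
Qed.

(** The uniform bound comes from the compactness of a rectangle of radii and
    angles; it is the domination needed to let the radius vary under the
    integral sign. *)
Lemma circle_bounded (g : Cplx R -> R) rho s : s < rho ->
  (forall z, nc z < rho -> {for z, continuous g}) ->
  exists M, forall r t, - s <= r <= s -> 0 <= t <= pi2 ->
    `|g (circle_point r t)| <= M.
Proof.
move=> srho cg.
pose A : set (R * R) := `[- s, s] `*` `[0, pi2].
have cA : compact A by apply: compact_setX; exact: segment_compact.
have : {within A, continuous (fun p : R * R => g (circle_point p.1 p.2))}.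
  apply: continuous_in_subspaceT => p /set_mem[/= + _]; rewrite in_itv/= => hp.
  apply: continuous_comp; first exact: continuous_circle_point.
  apply: cg; rewrite normc_circle_point.
  by rewrite (le_lt_trans _ srho)// ler_norml.
move/continuous_compact => /(_ cA) /compact_bounded [M [_ MP]].
exists (M + 1) => r t hr ht; apply: (MP (M + 1)); first by rewrite ltrDl.
by exists (r, t) => //; split; rewrite /= in_itv.
Qed.

Lemma circle_integrable (g : Cplx R -> R) r :
  (forall z, nc z = `|r| -> {for z, continuous g}) ->
  itgable 0 pi2 (fun t => g (circle_point r t)).
Proof.
move=> cg; apply: itgable_continuous => t _.
apply: (@continuous_comp _ _ _ (circle_point r) g); last first.
  by apply: cg; rewrite normc_circle_point.
exact: continuous_circle_angle.
Qed.

Lemma circle_integral_continuous (g : Cplx R -> R) rho r :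
  `|r| < rho -> (forall z, nc z < rho -> {for z, continuous g}) ->
  {for r, continuous (fun r => itg 0 pi2 (fun t => g (circle_point r t)))}.
Proof.
move=> rr cg; set s := (`|r| + rho) / 2.
have srho : s < rho by rewrite /s; lra.
have [M MP] := circle_bounded srho cg.
have sr x : `]- s, s[%classic x -> `|x| < rho.
  by rewrite /= in_itv/= => h; rewrite ltr_norml; lra.
apply: (@continuity_under_integral R _ _ lebesgue_measure
  (fun r t => g (circle_point r t)) `[0, pi2]%classic _ (- s) s _ _ (cst M)).
- exact: measurable_itv.
- by move=> x /sr xr; apply: circle_integrable => z zx; apply: cg; rewrite zx.
- apply: aeW => t _ x /set_mem /sr xr.
  change {for x, continuous (g \o (fun r => circle_point r t))}.
  apply: continuous_comp; first exact: continuous_circle_radius.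
  by apply: cg; rewrite normc_circle_point.
- exact: itgable_cst.
- move=> x; rewrite /= in_itv/= => hx; apply: aeW => t; rewrite /= in_itv/= => ht.
  apply: MP => //; lra.
- rewrite inE/= in_itv/=; have := ler_norm r; have := ler_norm (- r); rewrite normrN /s; lra.
Qed.

(** The integral is constant in the radius on either side of the exceptional
    circle; being continuous in the radius, it is constant across it and down
    to the radius [0], where the circle shrinks to a point. *)
Lemma circle_integral_Re_center f z0 rho r : 0 <= r < rho ->
  (forall z, nc z < rho -> {for z, continuous f}) ->
  (forall z, nc z < rho -> z != z0 -> exists D, cdiff f z D) ->
  itg 0 pi2 (fun t => complex.Re (f (circle_point r t))) = pi2 * complex.Re (f 0).
Proof.
move=> r01 cf df.
pose I r := itg 0 pi2 (fun t => complex.Re (f (circle_point r t))).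
have I0 : I 0 = pi2 * complex.Re (f 0).
  rewrite /I (@eq_itg _ _ _ _ (fun=> complex.Re (f 0))).
    by rewrite itg_cst ?subr0 1?mulrC// mulr_ge0// pi_ge0.
  by move=> t _; rewrite circle_point0.
have cI x : `|x| < rho -> {for x, continuous I}.
  move=> xr; have := @circle_integral_continuous (@complex.Re R \o f) rho x xr.
  apply=> z zr; apply: continuous_comp; [exact: cf|exact: continuous_Re].
have dI x y : 0 < x -> x <= y -> y < rho -> (y < nc z0 \/ nc z0 < x) -> I x = I y.
  move=> x0 xy yr h; apply: circle_integral_constant => // z hz.
  apply: df; first lra.
  by apply/eqP => ze; move: hz h; rewrite ze; lra.
rewrite -I0 -/(I r).
have const u v : 0 <= u -> u < v -> v < rho -> (v <= nc z0 \/ nc z0 <= u) ->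
    I u = I v.
  move=> u0 uv vr h.
  have Iu : I x @[x --> u^'+] --> I u.
    by apply: cvg_at_right_filter; apply: cI; rewrite ger0_norm//; lra.
  have Iv : I x @[x --> v^'-] --> I v.
    by apply: cvg_at_left_filter; apply: cI; rewrite gtr0_norm//; lra.
  pose m := (u + v) / 2.
  have um : u < m by rewrite /m; lra.
  have mv : m < v by rewrite /m; lra.
  have -> : I u = I m.
    apply: (cvg_unique _ Iu) => //; apply: cvg_near_cst.
    near=> x; apply: dI => //; try by rewrite /m; lra.
    + by apply: le_lt_trans u0 _; near: x; exact: nbhs_right_gt.
    + by apply: ltW; near: x; exact: nbhs_right_lt.
    + have : u < x by near: x; exact: nbhs_right_gt.
      by move: h; rewrite /m; lra.
  apply: (cvg_unique _ _ Iv) => //; apply: cvg_near_cst.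
  near=> x; apply/esym; apply: dI => //; try by rewrite /m; lra.
  + by apply: ltW; near: x; exact: nbhs_left_gt.
  + by apply: lt_trans vr; near: x; exact: nbhs_left_lt.
  + have : x < v by near: x; exact: nbhs_left_lt.
    by move: h; rewrite /m; lra.
have z00 := normc_ge0 z0.
have [->//|r0] := eqVneq r 0.
have {}r0 : 0 < r by lra.
have [rz|zr] := leP r (nc z0); first by apply/esym; apply: const; lra.
have [z0e|z0n] := eqVneq (nc z0) 0.
  by apply/esym; apply: const; rewrite ?z0e; lra.
have {}z0n : 0 < nc z0 by lra.
rewrite (const 0 (nc z0)); [|lra..].
by apply/esym; apply: const; lra.
Unshelve. all: by end_near. Qed.

End CircleMean.

(** * Averages over circles and the mean value property *)

Section CauchyFormula.
Context {R : realType}.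
Implicit Types (f g : Cplx R -> Cplx R) (z w c : Cplx R) (r t x : R).
Local Notation pi2 := (2 * pi : R).

Lemma pi2_gt0 : 0 < pi2.
Proof. by rewrite mulr_gt0// pi_gt0. Qed.

Definition circle_avg r f : Cplx R :=
  (itg 0 pi2 (fun t => complex.Re (f (circle_point r t))) / pi2 +i*
   (itg 0 pi2 (fun t => complex.Im (f (circle_point r t))) / pi2))%C.

Definition circle_avg_norm r f : R :=
  itg 0 pi2 (fun t => nc (f (circle_point r t))) / pi2.

Definition circle_continuous r f := forall z, nc z = r -> {for z, continuous f}.

Section FixedRadius.
Variable r : R.
Hypothesis r0 : 0 <= r.

Let cont_abs f : circle_continuous r f ->
  forall z, nc z = `|r| -> {for z, continuous f}.
Proof. by move=> cf z; rewrite ger0_norm//; exact: cf. Qed.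

Lemma itgable_circle_Re f : circle_continuous r f ->
  itgable 0 pi2 (fun t => complex.Re (f (circle_point r t))).
Proof.
move=> /cont_abs cf; apply: (@circle_integrable _ (@complex.Re R \o f)) => z zr.
by apply: continuous_comp; [exact: cf|exact: continuous_Re].
Qed.

Lemma itgable_circle_Im f : circle_continuous r f ->
  itgable 0 pi2 (fun t => complex.Im (f (circle_point r t))).
Proof.
move=> /cont_abs cf; apply: (@circle_integrable _ (@complex.Im R \o f)) => z zr.
by apply: continuous_comp; [exact: cf|exact: continuous_Im].
Qed.

Lemma itgable_circle_normc f : circle_continuous r f ->
  itgable 0 pi2 (fun t => nc (f (circle_point r t))).
Proof.
move=> /cont_abs cf; apply: (@circle_integrable _ (@Normc.normc R \o f)) => z zr.
by apply: continuous_comp; [exact: cf|exact: continuous_normc].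
Qed.

Lemma circle_avgD f g : circle_continuous r f -> circle_continuous r g ->
  circle_avg r (f \+ g) = circle_avg r f + circle_avg r g.
Proof.
move=> cf cg; apply/eqP; rewrite eq_complex /=.
rewrite -!mulrDl -!itgD; [|exact: itgable_circle_Im|exact: itgable_circle_Im
  |exact: itgable_circle_Re|exact: itgable_circle_Re].
by apply/andP; split; apply/eqP; congr (_ / _); apply: eq_itg => t _;
  case: (f _) (g _) => ? ? [].
Qed.

Lemma circle_avgZ c f : circle_continuous r f ->
  circle_avg r (fun z => c * f z) = c * circle_avg r f.
Proof.
move=> cf; have iR := itgable_circle_Re cf; have iI := itgable_circle_Im cf.
case: c => a b; apply/eqP; rewrite eq_complex /=; apply/andP; split; apply/eqP.
- rewrite !mulrA -mulrBl -!itgZ// -itgB; [|exact: itgableZ..].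
  by congr (_ / _); apply: eq_itg => t _; case: (f _).
- rewrite !mulrA -mulrDl -!itgZ// -itgD; [|exact: itgableZ..].
  by congr (_ / _); apply: eq_itg => t _; case: (f _).
Qed.

Lemma eq_circle_avg f g : (forall z, nc z = r -> f z = g z) ->
  circle_avg r f = circle_avg r g.
Proof.
move=> fg; have fgt t : f (circle_point r t) = g (circle_point r t).
  by apply: fg; rewrite normc_circle_point ger0_norm.
by rewrite /circle_avg; congr (_ / _ +i* (_ / _))%C; apply: eq_itg => t _; rewrite fgt.
Qed.

Lemma eq_circle_avg_norm f g : (forall z, nc z = r -> nc (f z) = nc (g z)) ->
  circle_avg_norm r f = circle_avg_norm r g.
Proof.
move=> fg; rewrite /circle_avg_norm; congr (_ / _); apply: eq_itg => t _.
by apply: fg; rewrite normc_circle_point ger0_norm.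
Qed.

Lemma circle_avg_conj f : circle_continuous r f ->
  circle_avg r (fun z => (f z)^*)%C = ((circle_avg r f)^*)%C.
Proof.
move=> cf; have iI := itgable_circle_Im cf.
apply/eqP; rewrite eq_complex /=; apply/andP; split; apply/eqP.
- by congr (_ / _); apply: eq_itg => t _; case: (f _).
- rewrite -mulNr -[- itg _ _ _]mulN1r -itgZ//; congr (_ / _).
  by apply: eq_itg => t _; case: (f _) => a b; rewrite mulN1r.
Qed.

Lemma normc_circle_avg f : circle_continuous r f ->
  nc (circle_avg r f) <= 2 * circle_avg_norm r f.
Proof.
move=> cf; rewrite (le_trans (normc_le_ReIm _))//= [leRHS]mulr_natl [leRHS]mulr2n.
have bound (g : Cplx R -> R) : (forall z, `|g z| <= nc z) ->
    itgable 0 pi2 (fun t => g (f (circle_point r t))) ->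
    `|itg 0 pi2 (fun t => g (f (circle_point r t))) / pi2| <= circle_avg_norm r f.
  move=> gn ig; rewrite normrM normfV (gtr0_norm pi2_gt0) ler_wpM2r//.
    by rewrite invr_ge0 ltW// pi2_gt0.
  have iN := itgable_circle_normc cf.
  rewrite ler_norml -mulN1r -itgZ//; apply/andP; split; apply: ler_itg => //.
  - exact: itgableZ.
  - by move=> t _; have := gn (f (circle_point r t)); rewrite ler_norml mulN1r => /andP[].
  - by move=> t _; have := gn (f (circle_point r t)); rewrite ler_norml => /andP[].
rewrite lerD//; apply: bound; [exact: Re_le_normc|exact: itgable_circle_Re
  |exact: Im_le_normc|exact: itgable_circle_Im].
Qed.

Lemma circle_avg_norm_le f g : circle_continuous r f -> circle_continuous r g ->
  (forall z, nc z = r -> nc (f z) <= nc (g z)) ->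
  circle_avg_norm r f <= circle_avg_norm r g.
Proof.
move=> cf cg fg; rewrite /circle_avg_norm ler_wpM2r ?invr_ge0 ?(ltW pi2_gt0)//.
apply: ler_itg; [exact: itgable_circle_normc..|].
by move=> t _; apply: fg; rewrite normc_circle_point ger0_norm.
Qed.

Lemma circle_avg_norm_ge0 f : 0 <= circle_avg_norm r f.
Proof.
rewrite divr_ge0 ?(ltW pi2_gt0)//; apply: Rintegral_ge0 => t _; exact: normc_ge0.
Qed.

Lemma circle_avg_normZ c f : circle_continuous r f ->
  circle_avg_norm r (fun z => c * f z) = nc c * circle_avg_norm r f.
Proof.
move=> cf; rewrite /circle_avg_norm mulrA -itgZ; last exact: itgable_circle_normc.
by congr (_ / _); apply: eq_itg => t _; rewrite normc_mul.
Qed.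

End FixedRadius.

Lemma cdiffZ c f z D : cdiff f z D -> cdiff (fun z => c * f z) z (c * D).
Proof.
by move=> df; have := cdiffM (cdiff_cst z c) df; rewrite mul0r add0r.
Qed.

(** The real part is [circle_integral_Re_center] for [f], and the imaginary
    part is the same statement for [- i f]. *)
Lemma circle_avg_center f z0 rho r : 0 <= r < rho ->
  (forall z, nc z < rho -> {for z, continuous f}) ->
  (forall z, nc z < rho -> z != z0 -> exists D, cdiff f z D) ->
  circle_avg r f = f 0.
Proof.
move=> rr cf df; apply/eqP; rewrite eq_complex /=.
have pn0 : pi2 != 0 by rewrite gt_eqF ?pi2_gt0.
apply/andP; split; apply/eqP.
  by rewrite (circle_integral_Re_center rr cf df) mulrC mulKf.
rewrite (@eq_itg _ _ _ _ (fun t => complex.Re (- 'i%C * f (circle_point r t)))); last first.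
  by move=> t _; case: (f _) => a b /=; rewrite !oppr0 !mul0r !add0r mulN1r opprK.
rewrite (@circle_integral_Re_center _ (fun z => - 'i%C * f z) z0 rho r rr).
- rewrite mulrC mulKf//; case: (f 0) => a b /=.
  by rewrite !oppr0 !mul0r !add0r mulN1r opprK.
- move=> z zr; apply: continuous_CplxM; [exact: continuous_Cplx_cst|exact: cf].
- by move=> z zr zz; have [D dD] := df z zr zz; exists (- 'i%C * D); exact: cdiffZ.
Qed.

End CauchyFormula.

(** * Cauchy's formula and Taylor expansion with remainder *)

Section CauchyIntegral.
Context {R : realType}.
Implicit Types (f g : Cplx R -> Cplx R) (z w c : Cplx R) (r t x : R).

Lemma normc_conj z : nc (z^*)%C = nc z.
Proof. by case: z => a b /=; rewrite sqrrN. Qed.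

Lemma normc_mul_conj z : z * (z^*)%C = ((nc z ^+ 2)%:C)%C.
Proof.
rewrite normc_sqr; case: z => a b /=; apply/eqP; rewrite eq_complex /=.
by apply/andP; split; apply/eqP; ring.
Qed.

(** On the circle of radius [r] the conjugate of [w] is [r^2 / w], so the kernel
    is there the conjugate of [1 / (1 - c w)] with [c = conj z0 / r^2]. That
    function is holomorphic on a disc of radius larger than [r], and the mean
    value property gives its average. *)
Lemma cauchy_kernel_avg z0 r : nc z0 < r ->
  circle_avg r (fun w => w / (w - z0)) = 1.
Proof.
move=> z0r; have r0 : 0 < r := le_lt_trans (normc_ge0 _) z0r.
pose c : Cplx R := (z0^* / ((r ^+ 2)%:C))%C.
pose f w : Cplx R := (1 - c * w)^-1.
(* any radius strictly between [r] and [r^2 / |z0|] would do *)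
pose rho := 2 * r ^+ 2 / (nc z0 + r).
have z0p := normc_ge0 z0.
have s0 : 0 < nc z0 + r by rewrite ltr_wpDl.
have ncc : nc c = nc z0 / r ^+ 2.
  by rewrite normc_mul normc_inv normc_conj normcr ger0_norm// exprn_ge0// ltW.
have rrho : 0 <= r < rho.
  rewrite (ltW r0) /rho ltr_pdivlMr// expr2 mulrA -mulrA mulrCA.
  by rewrite ltr_pM2l// mulr_natl mulr2n ltrD2r.
have den w : nc w < rho -> 1 - c * w != 0.
  move=> wr; apply/eqP => e.
  have : nc (c * w) = 1.
    move/eqP: e; rewrite subr_eq0 => /eqP <-; exact: Normc.normc1.
  rewrite normc_mul ncc => h.
  have : nc z0 / r ^+ 2 * nc w <= nc z0 / r ^+ 2 * rho.
    by rewrite ler_wpM2l ?(ltW wr)// divr_ge0// exprn_ge0// ltW.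
  rewrite h /rho.
  have -> : nc z0 / r ^+ 2 * (2 * r ^+ 2 / (nc z0 + r)) = 2 * nc z0 / (nc z0 + r).
    by field; rewrite gt_eqF//= gt_eqF.
  by rewrite ler_pdivlMr// mul1r; lra.
have df w : nc w < rho -> exists D, cdiff f w D.
  move=> /den w0; have := cdiffB (cdiff_cst w 1) (cdiffM (cdiff_cst w c) (cdiff_id w)).
  by move/cdiffV => /(_ w0) h; eexists; exact: h.
have cf w : nc w < rho -> {for w, continuous f}.
  by move=> /df[D]; exact: cdiff_continuous.
have avg1 : circle_avg r f = 1.
  rewrite (circle_avg_center (z0 := 0) rrho cf); last by move=> w wr _; exact: df.
  by rewrite /f mulr0 subr0 invr1.
have cfr : circle_continuous r f.
  by move=> w wr; apply: cf; rewrite wr; case/andP: rrho.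
rewrite (@eq_circle_avg _ _ (ltW r0) _ (fun w => (f w)^*)%C).
  rewrite (circle_avg_conj (ltW r0) cfr) avg1; exact: conjc1.
move=> w wr.
have w0 : w != 0 by rewrite -normc_gt0 wr.
have wz : w - z0 != 0.
  by rewrite subr_eq0; apply: contraTneq z0r => <-; rewrite wr ltxx.
have r2 : ((r ^+ 2)%:C)%C = w * (w^*)%C :> Cplx R by rewrite normc_mul_conj wr.
have cw0 : (w^*)%C != 0 :> Cplx R by rewrite -normc_gt0 normc_conj wr.
rewrite /f conjc_inv rmorphB rmorph1 rmorphM /c r2 rmorphM fmorphV rmorphM /=.
rewrite !conjcK.
field.
by rewrite ?w0 ?cw0 ?wz.
Qed.

Section Holomorphic.
Variable f : Cplx R -> Cplx R.
Hypothesis hf : forall z, nc z < 1 -> exists D, cdiff f z D.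

Let cf z : nc z < 1 -> {for z, continuous f}.
Proof. by move=> /hf[D]; exact: cdiff_continuous. Qed.

Lemma kernel_continuous z0 r : nc z0 < r ->
  circle_continuous r (fun w => w / (w - z0)).
Proof.
move=> z0r w wr; apply: continuous_CplxM; first exact: continuous_Cplx_id.
apply: continuous_CplxV.
  by rewrite subr_eq0; apply: contraTneq z0r => <-; rewrite wr ltxx.
by apply: continuous_CplxB; [exact: continuous_Cplx_id|exact: continuous_Cplx_cst].
Qed.

(** The mean value property for [w q(w)], where [q] is the difference quotient
    of [f] at [z0]: this function vanishes at [0] and is continuous at [z0], the
    only point where it might fail to be differentiable. *)
Lemma cauchy_formula z0 r : nc z0 < r -> r < 1 ->
  circle_avg r (fun w => f w * (w / (w - z0))) = f z0.
Proof.
move=> z0r r1; have r0 : 0 < r := le_lt_trans (normc_ge0 _) z0r.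
have z01 := lt_trans z0r r1.
have [D /cdiff_slope[q [cq qD fq]]] := hf z01.
pose phi w := w * q w.
have dphi w : nc w < 1 -> w != z0 -> exists D', cdiff phi w D'.
  move=> w1 wz; have [E dE] := hf w1.
  have wz0 : w - z0 != 0 by rewrite subr_eq0.
  have dq := cdiffM (cdiffB dE (cdiff_cst w (f z0)))
    (cdiffV (cdiffB (cdiff_id w) (cdiff_cst w z0)) wz0).
  have := cdiffM (cdiff_id w) dq.
  set E' := (X in cdiff _ _ X) => dphi; exists E'.
  apply: (@cdiff_near _ _ _ _ _ (nc (w - z0))) dphi; first by rewrite normc_gt0.
  move=> v vw; rewrite /phi; congr (_ * _).
  have vz0 : v - z0 != 0.
    by apply: contraTneq vw => /subr0_eq ->; rewrite normcB ltxx.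
  have -> : f v - f z0 = q v * (v - z0) by rewrite fq addrAC subrr add0r.
  by rewrite mulfK.
have cphi w : nc w < 1 -> {for w, continuous phi}.
  move=> w1; have [->|wz] := eqVneq w z0.
    by apply: continuous_CplxM; [exact: continuous_Cplx_id|exact: cq].
  by have [D'] := dphi w w1 wz; exact: cdiff_continuous.
have rr : 0 <= r < 1 by rewrite ltW.
have avg0 : circle_avg r phi = 0.
  by rewrite (circle_avg_center rr cphi dphi) /phi mul0r.
have cphir : circle_continuous r phi by move=> w wr; apply: cphi; rewrite wr.
have cK := kernel_continuous z0r.
rewrite (@eq_circle_avg _ _ (ltW r0) _ (phi \+ (fun w => f z0 * (w / (w - z0))))).
  rewrite (circle_avgD (ltW r0) cphir); last first.
    move=> w wr; apply: continuous_CplxM; [exact: continuous_Cplx_cst|exact: (cK _ wr)].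
  rewrite avg0 add0r (circle_avgZ (ltW r0) _ cK).
  by rewrite (cauchy_kernel_avg z0r) mulr1.
move=> w wr /=; rewrite /phi.
have wz : w - z0 != 0.
  by rewrite subr_eq0; apply: contraTneq z0r => <-; rewrite wr ltxx.
have {1}-> : f w = f z0 + q w * (w - z0) by exact: fq.
by field.
Qed.

Definition cauchy_coef r k : Cplx R :=
  circle_avg r (fun w => f w * w^-1 ^+ k).

Lemma inv_pow_continuous r k : 0 < r ->
  circle_continuous r (fun w : Cplx R => w^-1 ^+ k).
Proof.
move=> r0 w wr; apply: continuous_CplxX; apply: continuous_CplxV.
  by rewrite -normc_gt0 wr.
exact: continuous_Cplx_id.
Qed.

Let cfr r : r < 1 -> circle_continuous r f.
Proof. by move=> r1 w wr; apply: cf; rewrite wr. Qed.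

Lemma normc_cauchy_coef r k : 0 < r -> r < 1 ->
  nc (cauchy_coef r k) <= 2 * (r ^- k * circle_avg_norm r f).
Proof.
move=> r0 r1; have cc : circle_continuous r (fun w => f w * w^-1 ^+ k).
  move=> w wr; apply: continuous_CplxM; first exact: (cfr r1 wr).
  exact: (inv_pow_continuous r0 wr).
apply: (le_trans (normc_circle_avg (ltW r0) cc)); rewrite ler_wpM2l//.
rewrite (@eq_circle_avg_norm _ _ (ltW r0) _ (fun w => ((r ^- k)%:C)%C * f w)).
  rewrite (circle_avg_normZ (ltW r0)); last exact: (cfr r1).
  by rewrite normcr ger0_norm// invr_ge0 exprn_ge0// ltW.
move=> w wr; rewrite !normc_mul normc_exp normc_inv wr normcr exprVn mulrC ger0_norm//.
by rewrite invr_ge0 exprn_ge0// ltW.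
Qed.

Let remainder z0 r n : Cplx R :=
  circle_avg r (fun w => (f w * (w / (w - z0))) * (z0 / w) ^+ n).

Let remainder_continuous z0 r n : nc z0 < r -> r < 1 ->
  circle_continuous r (fun w => (f w * (w / (w - z0))) * (z0 / w) ^+ n).
Proof.
move=> z0r r1 w wr; have r0 : 0 < r := le_lt_trans (normc_ge0 _) z0r.
apply: continuous_CplxM; last first.
  apply: continuous_CplxX; apply: continuous_CplxM; first exact: continuous_Cplx_cst.
  by apply: continuous_CplxV; [rewrite -normc_gt0 wr|exact: continuous_Cplx_id].
by apply: continuous_CplxM; [exact: (cfr r1 wr)|exact: (kernel_continuous z0r wr)].
Qed.

(** Each step replaces the kernel [K = w / (w - z0)] by [1 + (z0 / w) K]. *)
Lemma taylor_remainder z0 r n : nc z0 < r -> r < 1 ->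
  f z0 = \sum_(k < n) cauchy_coef r k * z0 ^+ k + remainder z0 r n.
Proof.
move=> z0r r1; have r0 : 0 < r := le_lt_trans (normc_ge0 _) z0r.
elim: n => [|n ih].
  rewrite big_ord0 add0r /remainder -(cauchy_formula z0r r1).
  by apply: (eq_circle_avg (ltW r0)) => w _; rewrite expr0 mulr1.
rewrite {1}ih big_ord_recr /= -addrA; congr (_ + _).
have c1 : circle_continuous r (fun w => f w * w^-1 ^+ n).
  move=> w wr; apply: continuous_CplxM; first exact: (cfr r1 wr).
  exact: (inv_pow_continuous r0 wr).
have c2 : circle_continuous r (fun w => z0 ^+ n * (f w * w^-1 ^+ n)).
  by move=> w wr; apply: continuous_CplxM; [exact: continuous_Cplx_cst|exact: (c1 _ wr)].
have c3 := @remainder_continuous z0 r n.+1 z0r r1.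
rewrite /cauchy_coef mulrC -(circle_avgZ (ltW r0) _ c1).
rewrite /remainder -(circle_avgD (ltW r0) c2 c3).
apply: (eq_circle_avg (ltW r0)) => w wr /=.
have w0 : w != 0 by rewrite -normc_gt0 wr.
have wz : w - z0 != 0.
  by rewrite subr_eq0; apply: contraTneq z0r => <-; rewrite wr ltxx.
rewrite exprS exprMn.
move: (z0 ^+ n) (w^-1 ^+ n) (f w) => a b c; by field; rewrite w0 wz.
Qed.

Lemma normc_kernel z0 w : nc z0 < nc w ->
  nc (w / (w - z0)) <= nc w / (nc w - nc z0).
Proof.
move=> zw; rewrite normc_mul normc_inv ler_wpM2l ?normc_ge0// lef_pV2 ?posrE ?subr_gt0//.
  by have := lerB_normcD w (- z0); rewrite normc_opp.
rewrite normc_gt0 subr_eq0; by apply: contraTneq zw => ->; rewrite ltxx.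
Qed.

Lemma normc_taylor_remainder z0 r n : nc z0 < r -> r < 1 ->
  nc (f z0 - \sum_(k < n) cauchy_coef r k * z0 ^+ k) <=
  2 * (r / (r - nc z0) * circle_avg_norm r f) * (nc z0 / r) ^+ n.
Proof.
move=> z0r r1; have r0 : 0 < r := le_lt_trans (normc_ge0 _) z0r.
rewrite {1}(taylor_remainder n z0r r1) addrAC subrr add0r.
have c3 := @remainder_continuous z0 r n z0r r1.
apply: (le_trans (normc_circle_avg (ltW r0) c3)); rewrite -mulrA ler_wpM2l//.
have k0 : 0 <= r / (r - nc z0) * (nc z0 / r) ^+ n.
  by rewrite mulr_ge0 ?exprn_ge0 ?divr_ge0 ?normc_ge0// ?subr_ge0 ltW.
rewrite mulrAC -(ger0_norm k0) -normcr -(circle_avg_normZ (ltW r0)); last exact: (cfr r1).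
apply: (circle_avg_norm_le (ltW r0)); first exact: c3.
  by move=> w wr; apply: continuous_CplxM; [exact: continuous_Cplx_cst|exact: (cfr r1 wr)].
move=> w wr.
have -> : nc (f w * (w / (w - z0)) * (z0 / w) ^+ n) =
    nc (f w) * nc (w / (w - z0)) * (nc z0 / r) ^+ n.
  by rewrite normc_mul (normc_mul (f w)) normc_exp (normc_mul z0) normc_inv wr.
rewrite [leRHS]normc_mul normcr (ger0_norm k0) -mulrA [leLHS]mulrC.
rewrite ler_wpM2r ?normc_ge0// ler_wpM2r ?exprn_ge0 ?divr_ge0 ?normc_ge0 ?(ltW r0)//.
by rewrite -wr normc_kernel// wr.
Qed.

Lemma normc_le_circle_avg z0 r : nc z0 < r -> r < 1 ->
  nc (f z0) <= 2 * (r / (r - nc z0) * circle_avg_norm r f).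
Proof.
move=> z0r r1; have := normc_taylor_remainder 0 z0r r1.
by rewrite big_ord0 subr0 expr0 mulr1.
Qed.

End Holomorphic.
End CauchyIntegral.

(** * Power series and Taylor coefficients *)

Section PowerSeries.
Context {R : realType}.
Implicit Types (a b : nat -> Cplx R) (z w : Cplx R) (r s e q : R).

Definition psum a n z : Cplx R := \sum_(k < n) a k * z ^+ k.

Definition power_sum a z (l : Cplx R) := forall e : R, 0 < e ->
  exists N, forall n, (N <= n)%N -> nc (psum a n z - l) <= e.

(** The Cauchy-Hadamard condition that the radius of convergence is at least
    [r], in a form that needs no root or upper limit. *)
Definition radius_ge a r := forall s, 0 < s -> s < r ->
  exists C : R, forall k, nc (a k) * s ^+ k <= C.

Definition pderiv a k : Cplx R := k.+1%:R * a k.+1.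

(** This bounds [k q^k] by [1 / (1 - q)]; it is what makes the condition
    [radius_ge] stable under differentiation. *)
Lemma natmul_geometric q k : 0 <= q <= 1 -> k%:R * q ^+ k * (1 - q) <= 1 - q ^+ k.
Proof.
move=> /andP[q0 q1]; elim: k => [|k ih]; first by rewrite !mul0r expr0 subrr.
have qk0 : 0 <= q ^+ k by rewrite exprn_ge0.
have qk1 : q ^+ k <= 1 by rewrite exprn_ile1.
rewrite exprS -natr1.
have h1 : q * (k%:R * q ^+ k * (1 - q)) <= q * (1 - q ^+ k) by rewrite ler_wpM2l.
have h2 : 0 <= (1 - q) * (1 - q * q ^+ k).
  by rewrite mulr_ge0 ?subr_ge0// mulr_ile1.
by move: h1 h2; lra.
Qed.

Lemma radius_ge_natmul a r : radius_ge a r ->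
  radius_ge (fun k => k%:R * a k : Cplx R) r.
Proof.
move=> ra s s0 sr; pose s' := (s + r) / 2.
have ss' : s < s' by rewrite /s'; lra.
have s'0 : 0 < s' by exact: lt_trans ss'.
have [C CP] := ra s' s'0 ltac:(rewrite /s'; lra).
pose q := s / s'.
have q1 : q < 1 by rewrite ltr_pdivrMr// mul1r.
have q0 : 0 <= q by rewrite divr_ge0// ltW.
exists (C / (1 - q)) => k.
rewrite normc_mul normc_nat ler_pdivlMr ?subr_gt0//.
have -> : k%:R * nc (a k) * s ^+ k * (1 - q) =
    (nc (a k) * s' ^+ k) * (k%:R * q ^+ k * (1 - q)).
  have -> : q ^+ k = s ^+ k / s' ^+ k by exact: expr_div_n.
  by field; rewrite expf_neq0// gt_eqF.
have C0 : 0 <= C by apply: le_trans (CP k); rewrite mulr_ge0 ?normc_ge0 ?exprn_ge0 ?ltW.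
rewrite -[leRHS]mulr1 ler_pM// ?mulr_ge0 ?normc_ge0 ?exprn_ge0 ?(ltW s'0)//.
  by rewrite subr_ge0 ltW.
apply: le_trans (natmul_geometric k _) _; first by rewrite q0 ltW.
by rewrite gerBl exprn_ge0.
Qed.

Lemma radius_ge_deriv a r : radius_ge a r -> radius_ge (pderiv a) r.
Proof.
move=> /radius_ge_natmul ra s s0 sr; have [C CP] := ra s s0 sr.
exists (C / s) => k; rewrite ler_pdivlMr// -mulrA -exprSr; exact: CP.
Qed.

Lemma radius_ge_sum a r s : radius_ge a r -> 0 < s -> s < r ->
  exists C : R, forall n, \sum_(k < n) nc (a k) * s ^+ k <= C.
Proof.
move=> ra s0 sr; pose s' := (s + r) / 2.
have ss' : s < s' by rewrite /s'; lra.
have s'0 : 0 < s' by exact: lt_trans ss'.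
have [C CP] := ra s' s'0 ltac:(rewrite /s'; lra).
have C0 : 0 <= C by apply: le_trans (CP 0%N); rewrite expr0 mulr1 normc_ge0.
pose q := s / s'.
have q1 : q < 1 by rewrite ltr_pdivrMr// mul1r.
have q0 : 0 <= q by rewrite divr_ge0// ltW.
exists (C / (1 - q)) => n.
apply: (@le_trans _ _ (\sum_(k < n) C * q ^+ k)).
  apply: ler_sum => k _; rewrite /q expr_div_n mulrA ler_pdivlMr ?exprn_gt0//.
  by rewrite mulrAC ler_wpM2r ?exprn_ge0// ltW.
rewrite -mulr_sumr ler_wpM2l// -[leLHS]opprK -[(1 - q)^-1]mul1r ler_pdivlMr ?subr_gt0//.
rewrite opprK mulrC.
have -> : (1 - q) * (\sum_(k < n) q ^+ k) = 1 - q ^+ n.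
  by rewrite -opprB mulNr -subrX1 opprB.
by rewrite gerBl exprn_ge0.
Qed.

Lemma psum_natmul a n z :
  \sum_(k < n.+1) a k * (k%:R * z ^+ k.-1) = psum (pderiv a) n z.
Proof.
rewrite big_ord_recl /= mul0r mulr0 add0r; apply: eq_bigr => k _.
by rewrite /pderiv /= /bump add1n /= mulrA [a _ * _]mulrC.
Qed.

(** The factor [s ^+ 2] stands on the left so that no exponent [k - 2] occurs. *)
Lemma power_second_order z w s k : nc z <= s -> nc w <= s ->
  nc (w ^+ k - z ^+ k - k%:R * z ^+ k.-1 * (w - z)) * s ^+ 2 <=
  (k ^ 2)%:R * s ^+ k * nc (w - z) ^+ 2.
Proof.
move=> zs ws; have s0 : 0 <= s := le_trans (normc_ge0 _) zs.
elim: k => [|k ih].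
  by rewrite !expr0 subrr !mul0r subrr Normc.normc0 mul0r.
have -> : w ^+ k.+1 - z ^+ k.+1 - k.+1%:R * z ^+ k.+1.-1 * (w - z) =
    w * (w ^+ k - z ^+ k - k%:R * z ^+ k.-1 * (w - z)) +
    k%:R * z ^+ k.-1 * (w - z) ^+ 2.
  case: k {ih} => [|k] /=; first by rewrite !expr0 !expr1; ring.
  rewrite !exprS -!natr1; ring.
have d0 : 0 <= nc (w - z) ^+ 2 by rewrite exprn_ge0// normc_ge0.
apply: (@le_trans _ _ ((s * nc (w ^+ k - z ^+ k - k%:R * z ^+ k.-1 * (w - z)) +
    k%:R * s ^+ k.-1 * nc (w - z) ^+ 2) * s ^+ 2)).
  rewrite ler_wpM2r ?exprn_ge0// (le_trans (ler_normcD _ _))// lerD//.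
    by rewrite normc_mul ler_wpM2r ?normc_ge0.
  rewrite normc_mul normc_exp normc_mul normc_nat normc_exp ler_wpM2r// ler_wpM2l//.
  by rewrite lerXn2r ?nnegrE ?normc_ge0.
rewrite mulrDl -mulrA.
apply: (@le_trans _ _ (s * ((k ^ 2)%:R * s ^+ k * nc (w - z) ^+ 2) +
  k%:R * s ^+ k.+1 * nc (w - z) ^+ 2)).
  rewrite lerD// ?ler_wpM2l// mulrAC ler_wpM2r//.
  case: k {ih} => [|k]; first by rewrite !mul0r.
  by rewrite /= -mulrA -exprD addn2.
have -> : s * ((k ^ 2)%:R * s ^+ k * nc (w - z) ^+ 2) +
  k%:R * s ^+ k.+1 * nc (w - z) ^+ 2 =
  (k ^ 2 + k)%:R * s ^+ k.+1 * nc (w - z) ^+ 2.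
  by rewrite [s ^+ k.+1]exprS natrD; ring.
rewrite ler_wpM2r// ler_wpM2r ?exprn_ge0// ler_nat.
by rewrite -[k.+1]addn1 sqrnD; lia.
Qed.

(** The partial sums satisfy a second order Taylor estimate whose constant does
    not depend on the number of terms, so it passes to the limit. *)
Lemma cdiff_power_sum a r (F : Cplx R -> Cplx R) z L : radius_ge a r ->
  (forall w, nc w < r -> power_sum a w (F w)) -> nc z < r ->
  power_sum (pderiv a) z L -> cdiff F z L.
Proof.
move=> ra aF zr aL; have z0 := normc_ge0 z.
pose s := (nc z + r) / 2.
have sr : s < r by rewrite /s; lra.
have zs : nc z < s by rewrite /s; lra.
have s0 : 0 < s by exact: le_lt_trans zs.
have [C CP] := radius_ge_sum (radius_ge_natmul (radius_ge_natmul ra)) s0 sr.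
have C0 : 0 <= C by have := CP 0%N; rewrite big_ord0.
have est w : nc w < s ->
    nc (F w - F z - L * (w - z)) * s ^+ 2 <= C * nc (w - z) ^+ 2.
  move=> ws; have s20 : 0 < s ^+ 2 by rewrite exprn_gt0.
  apply/ler_addgt0Pl => e e0.
  have m0 : 0 < s ^+ 2 * (2 + nc (w - z)).
    by rewrite mulr_gt0// ltr_wpDr ?normc_ge0.
  pose d := e / (s ^+ 2 * (2 + nc (w - z))).
  have d0 : 0 < d by rewrite divr_gt0.
  have [N1 h1] := aF w (lt_trans ws sr) d d0.
  have [N2 h2] := aF z zr d d0.
  have [N3 h3] := aL d d0.
  pose n := (maxn N1 (maxn N2 N3))%N.
  have {}h1 := h1 n.+1 (leqW (leq_maxl _ _)).
  have {}h2 := h2 n.+1 (leqW (leq_trans (leq_maxl N2 N3) (leq_maxr N1 _))).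
  have {}h3 := h3 n (leq_trans (leq_maxr N2 N3) (leq_maxr N1 _)).
  have h4 : nc (psum a n.+1 w - psum a n.+1 z - psum (pderiv a) n z * (w - z)) * s ^+ 2 <=
      C * nc (w - z) ^+ 2.
    rewrite -psum_natmul /psum -sumrB mulr_suml -sumrB.
    apply: (@le_trans _ _ (\sum_(k < n.+1)
        nc (a k) * ((k ^ 2)%:R * s ^+ k * nc (w - z) ^+ 2))).
      apply: (le_trans (ler_wpM2r (ltW s20) (ler_normc_sum _ _ _))).
      rewrite mulr_suml; apply: ler_sum => k _.
      have -> : a k * w ^+ k - a k * z ^+ k - a k * (k%:R * z ^+ k.-1) * (w - z) =
          a k * (w ^+ k - z ^+ k - k%:R * z ^+ k.-1 * (w - z)).
        by rewrite !mulrBr !mulrA.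
      rewrite (normc_mul (a k)) -[leLHS]mulrA ler_wpM2l ?normc_ge0//.
      by apply: power_second_order; exact: ltW.
    have := CP n.+1; move/(ler_wpM2r (exprn_ge0 2 (normc_ge0 (w - z)))).
    apply: le_trans; rewrite mulr_suml le_eqVlt; apply/orP; left; apply/eqP.
    by apply: eq_bigr => k _; rewrite !normc_mul !normc_nat natrX; ring.
  have -> : F w - F z - L * (w - z) =
      - (psum a n.+1 w - F w) + (psum a n.+1 z - F z)
      + (psum (pderiv a) n z - L) * (w - z) +
      (psum a n.+1 w - psum a n.+1 z - psum (pderiv a) n z * (w - z)) by ring.
  apply: (@le_trans _ _ ((d + d + d * nc (w - z)) * s ^+ 2 +
    nc (psum a n.+1 w - psum a n.+1 z - psum (pderiv a) n z * (w - z)) * s ^+ 2)).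
    rewrite -mulrDl ler_wpM2r ?(ltW s20)//.
    rewrite (le_trans (ler_normcD _ _))// lerD2r.
    rewrite (le_trans (ler_normcD _ _))// lerD//.
      by rewrite (le_trans (ler_normcD _ _))// normc_opp lerD.
    by rewrite normc_mul ler_wpM2r// normc_ge0.
  apply: lerD => //.
  rewrite (_ : _ * _ = e)// /d; field.
  by rewrite !gt_eqF// ltr_wpDr ?normc_ge0.
move=> e e0; have s2 : 0 < s ^+ 2 by rewrite exprn_gt0.
have C1 : 0 < C + 1 by rewrite ltr_wpDl.
exists (Num.min (s - nc z) (e * s ^+ 2 / (C + 1))).
  by rewrite lt_min subr_gt0 zs /= divr_gt0// mulr_gt0.
move=> w; rewrite lt_min => /andP[w1 w2].
have ws : nc w < s.
  by have := ler_normcD (w - z) z; rewrite subrK; lra.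
rewrite -(ler_pM2r s2) (le_trans (est w ws))// mulrAC expr2 mulrA ler_wpM2r ?normc_ge0//.
move: w2; rewrite ltr_pdivlMr// => w2; apply: le_trans (ltW w2).
by rewrite mulrC ler_wpM2l ?normc_ge0// lerDl.
Qed.
End PowerSeries.

Section TaylorCoefficients.
Context {R : realType}.
Implicit Types (a b : nat -> Cplx R) (f g : Cplx R -> Cplx R) (z w : Cplx R)
  (r s e q : R).

(** The real and the imaginary parts converge absolutely. *)
Lemma power_sum_ex a r z : radius_ge a r -> nc z < r ->
  exists l, power_sum a z l.
Proof.
move=> ra zr; have z0 := normc_ge0 z; pose s := (nc z + r) / 2.
have [C CP] := @radius_ge_sum _ a r s ra ltac:(rewrite /s; lra) ltac:(rewrite /s; lra).
have abs_cvg (p : Cplx R -> R) : (forall w, `|p w| <= nc w) ->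
    cvgn (series (fun k => p (a k * z ^+ k))).
  move=> pn; apply: normed_cvg; apply: nondecreasing_is_cvgn.
    by apply: nondecreasing_series => k _ _; exact: normr_ge0.
  exists C => _ [n _ <-]; rewrite /= /series /= big_mkord.
  apply: le_trans (CP n); apply: ler_sum => k _; apply: le_trans (pn _) _.
  rewrite normc_mul normc_exp ler_wpM2l ?normc_ge0// lerXn2r ?nnegrE ?normc_ge0//;
    rewrite /s; lra.
have /cvg_ex[lR hR] := abs_cvg _ (@Re_le_normc R).
have /cvg_ex[lI hI] := abs_cvg _ (@Im_le_normc R).
exists (lR +i* lI)%C => e e0; have e20 : 0 < e / 2 by rewrite divr_gt0.
move/cvgrPdist_le: hR => /(_ _ e20)[N1 _ h1].
move/cvgrPdist_le: hI => /(_ _ e20)[N2 _ h2].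
exists (maxn N1 N2) => n; rewrite geq_max => /andP[n1 n2].
rewrite normcB (le_trans (normc_le_ReIm _))// [leRHS]splitr.
have := h1 n n1; have := h2 n n2.
rewrite /= /series /= !big_mkord /psum.
have -> : \sum_(k < n) complex.Re (a k * z ^+ k) = complex.Re (\sum_(k < n) a k * z ^+ k).
  by elim/big_rec2 : _ => // i x y _ ->; case: (_ * _) x => ? ? [].
have -> : \sum_(k < n) complex.Im (a k * z ^+ k) = complex.Im (\sum_(k < n) a k * z ^+ k).
  by elim/big_rec2 : _ => // i x y _ ->; case: (_ * _) x => ? ? [].
by case: (\sum_(k < n) _) => x y /= ? ?; rewrite lerD.
Qed.

Lemma power_sum0 a l : power_sum a 0 l -> l = a 0%N.
Proof.
move=> al; apply/eqP; rewrite eq_sym -subr_eq0 -normc_eq0 eq_le normc_ge0 andbT.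
apply/ler_addgt0Pl => e /al[N /(_ N.+1 (leqnSn N))]; rewrite addr0.
rewrite /psum big_ord_recl expr0 mulr1 big1 ?addr0// => k _.
by rewrite /= /bump add1n exprS mul0r mulr0.
Qed.

Lemma derive1n_power_sum a r f k : 0 < r -> radius_ge a r ->
  (forall w, nc w < r -> power_sum a w (f w)) ->
  derive1n k f 0 = k`!%:R * a k.
Proof.
move=> r0; elim: k a f => [|k ih] a f ra af.
  rewrite derive1n0 fact0 mul1r; apply: power_sum0.
  by apply: af; rewrite Normc.normc0.
rewrite derive1Sn (ih (pderiv a)).
- by rewrite /pderiv factS mulrA natrM [_%:R * k`!%:R]mulrC.
- exact: radius_ge_deriv.
- move=> w wr; have [L aL] := power_sum_ex (radius_ge_deriv ra) wr.
  have /cdiffP df := cdiff_power_sum ra af wr aL.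
  by rewrite derive1E derive_val.
Qed.

Lemma taylor_coef_power_sum a r f k : 0 < r -> radius_ge a r ->
  (forall w, nc w < r -> power_sum a w (f w)) -> taylor_coef f k = a k.
Proof.
move=> r0 ra af; rewrite /taylor_coef (derive1n_power_sum k r0 ra af) mulrAC mulfV ?mul1r//.
Qed.

(** Cauchy's formula expands [f] in a power series with these coefficients, and
    differentiating that series term by term identifies them. *)
Lemma taylor_coef_cauchy f r k : 0 < r -> r < 1 ->
  (forall z, nc z < 1 -> exists D, cdiff f z D) ->
  taylor_coef f k = cauchy_coef f r k.
Proof.
move=> r0 r1 hf; pose A := circle_avg_norm r f.
have A0 : 0 <= A := circle_avg_norm_ge0 r f.
apply: (@taylor_coef_power_sum (cauchy_coef f r) r) => //.
  move=> s s0 sr; exists (2 * A) => n.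
  apply: (le_trans (ler_wpM2r (exprn_ge0 n (ltW s0)) (normc_cauchy_coef hf n r0 r1))).
  rewrite -mulrA ler_wpM2l// -/A mulrAC -[leRHS]mul1r ler_wpM2r//.
  rewrite -exprVn -exprMn exprn_ile1 ?mulr_ge0 ?invr_ge0 ?ltW//.
  by rewrite mulrC ltr_pdivrMr// mul1r.
move=> w wr e e0; set K := 2 * (r / (r - nc w) * A).
have K0 : 0 <= K by rewrite /K mulr_ge0// mulr_ge0// divr_ge0 ?subr_ge0 ?(ltW r0) ?(ltW wr).
have q1 : `|nc w / r| < 1.
  by rewrite ger0_norm ?divr_ge0 ?normc_ge0 ?(ltW r0)// ltr_pdivrMr// mul1r.
have K1 : 0 < e / (K + 1) by rewrite divr_gt0// ltr_wpDl.
have /cvgrPdist_le/(_ _ K1)[N _ NP] := cvg_expr q1.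
exists N => n /NP; rewrite sub0r normrN.
rewrite ger0_norm ?exprn_ge0 ?divr_ge0 ?normc_ge0 ?(ltW r0)// => h.
have := normc_taylor_remainder hf n wr r1; rewrite -/A -/K normcB => /le_trans; apply.
apply: (le_trans (ler_wpM2l K0 h)).
by rewrite mulrCA ger_pMr// ler_pdivrMr ?ltr_wpDl// mul1r lerDl.
Qed.

Lemma taylor_coefD f g k :
  (forall z, nc z < 1 -> exists D, cdiff f z D) ->
  (forall z, nc z < 1 -> exists D, cdiff g z D) ->
  (forall z, nc z < 1 -> exists D, cdiff (f \+ g) z D) ->
  taylor_coef (f \+ g) k = taylor_coef f k + taylor_coef g k.
Proof.
move=> hf hg hfg; have r0 : (0 : R) < 2^-1 by rewrite invr_gt0.
have r1 : 2^-1 < 1 :> R by rewrite invf_lt1// ltr1n.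
rewrite !(taylor_coef_cauchy k r0 r1)// /cauchy_coef.
have cont u : (forall z, nc z < 1 -> exists D, cdiff u z D) ->
    circle_continuous (2^-1 : R) (fun w => u w * w^-1 ^+ k).
  move=> hu w wr; apply: continuous_CplxM; last exact: (inv_pow_continuous r0 wr).
  by have [|D] := hu w; [rewrite wr|exact: cdiff_continuous].
rewrite -(circle_avgD (ltW r0) (cont _ hf) (cont _ hg)).
by apply: (eq_circle_avg (ltW r0)) => w _ /=; rewrite mulrDl.
Qed.

Lemma taylor_coefZ (c : Cplx R) f k :
  (forall z, nc z < 1 -> exists D, cdiff f z D) ->
  taylor_coef (fun w => c * f w) k = c * taylor_coef f k.
Proof.
move=> hf; have r0 : (0 : R) < 2^-1 by rewrite invr_gt0.
have r1 : 2^-1 < 1 :> R by rewrite invf_lt1// ltr1n.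
have hcf z : nc z < 1 -> exists D, cdiff (fun w => c * f w) z D.
  by move=> /hf[D dD]; exists (c * D); exact: cdiffZ.
rewrite !(taylor_coef_cauchy k r0 r1)// /cauchy_coef -(circle_avgZ (ltW r0)).
  by apply: (eq_circle_avg (ltW r0)) => w _ /=; rewrite mulrA.
move=> w wr; apply: continuous_CplxM; last exact: (inv_pow_continuous r0 wr).
by have [|D] := hf w; [rewrite wr|exact: cdiff_continuous].
Qed.

End TaylorCoefficients.

(** * Taylor coefficients are controlled by means of order less than one *)

Section PowerMeans.
Context {R : realType}.
Implicit Types (u : Cplx R -> Cplx R) (z w : Cplx R) (p r : R).
Local Notation pi2 := (2 * pi : R).

Definition power_mean p u r : R :=
  itg 0 pi2 (fun t => nc (u (circle_point r t)) `^ p) / pi2.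

Lemma itgable_powR (a b p M : R) (g : R -> R) : 0 <= p -> itgable a b g ->
  (forall x, a <= x <= b -> 0 <= g x <= M) -> itgable a b (fun x => g x `^ p).
Proof.
move=> p0 ig gM; apply: measurable_bounded_integrable => //.
- by rewrite /= lebesgue_measure_itv/=; case: ifP => _; rewrite ltry.
- apply: (measurableT_comp (measurable_realfun.measurable_powR p)).
  by apply/measurable_realfun.measurable_EFinP; apply: measurable_int ig.
- exists (M `^ p); split; first exact: num_real.
  move=> x Mx t /=; rewrite in_itv/= => /gM /andP[g0 gM'].
  rewrite ger0_norm ?powR_ge0// (le_trans _ (ltW Mx))//.
  by rewrite ge0_ler_powR ?nnegrE// (le_trans g0).
Qed.

Lemma itgable_power_mean p u r : 0 <= p -> 0 <= r -> circle_continuous r u ->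
  itgable 0 pi2 (fun t => nc (u (circle_point r t)) `^ p).
Proof.
move=> p0 r0 cu; have iu := itgable_circle_normc r0 cu.
have ct : {in `[0, pi2], continuous (fun t => nc (u (circle_point r t)))}.
  move=> t _; apply: (@continuous_comp _ _ _ (circle_point r) (@Normc.normc R \o u)).
    exact: continuous_circle_angle.
  apply: continuous_comp; last exact: continuous_normc.
  by apply: cu; rewrite normc_circle_point ger0_norm.
have p2 : 0 <= pi2 by exact: ltW (pi2_gt0 (R := R)).
have wct : {within `[0, pi2], continuous (fun t => nc (u (circle_point r t)))}.
  by apply: continuous_in_subspaceT => t /set_mem; exact: ct.
have [c _ cP] := EVT_max p2 wct.
apply: (itgable_powR p0 iu (M := nc (u (circle_point r c)))) => t ht.
by rewrite normc_ge0/= cP// in_itv.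
Qed.

Lemma circle_avg_norm_cst r (c : Cplx R) : 0 <= r ->
  circle_avg_norm r (fun=> c) = nc c.
Proof.
by move=> r0; rewrite /circle_avg_norm itg_cst ?(ltW pi2_gt0)// subr0 mulfK// gt_eqF// pi2_gt0.
Qed.

(** From [|u| = |u|^(1-p) |u|^p <= B^(1-p) |u|^p]. *)
Lemma circle_avg_norm_power_mean p u r B : 0 < p < 1 -> 0 <= r ->
  circle_continuous r u ->
  (forall z, nc z = r -> nc (u z) <= B) ->
  circle_avg_norm r u <= B `^ (1 - p) * power_mean p u r.
Proof.
move=> /andP[p0 p1] r0 cu uB.
have iP := itgable_power_mean (ltW p0) r0 cu.
rewrite /power_mean mulrA -itgZ// ler_wpM2r ?invr_ge0 ?(ltW pi2_gt0)//.
apply: ler_itg; [exact: itgable_circle_normc|exact: itgableZ|].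
move=> t _; set x := nc _; have x0 : 0 <= x := normc_ge0 _.
have xB : x <= B by apply: uB; rewrite normc_circle_point ger0_norm.
have [->|xn0] := eqVneq x 0; first by rewrite mulr_ge0 ?powR_ge0.
rewrite -{1}(powRr1 x0) -{1}(subrK p 1) powRD; last by rewrite xn0 implybT.
rewrite ler_wpM2r ?powR_ge0// ge0_ler_powR ?nnegrE ?subr_ge0 ?(ltW p1)//.
exact: le_trans xB.
Qed.

(** For [p < 1] the function [|u|^p] is not controlled by its means through
    Cauchy's formula directly. Writing [|u| = |u|^(1-p) |u|^p] on a circle
    halfway to the boundary and estimating the first factor by the supremum
    [S] below gives [S <= K A S^(1-p)], that is [S^p <= K A]; the weight is
    chosen so that the powers of the distance to the boundary cancel. *)
Lemma weighted_sup_bound p u (A : R) : 0 < p < 1 ->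
  (forall z, nc z < 1 -> exists D, cdiff u z D) ->
  (forall r, 0 < r < 1 -> power_mean p u r <= A) ->
  exists S, [/\ 0 <= S,
    forall z, nc z < 2^-1 -> (2^-1 - nc z) `^ p^-1 * nc (u z) <= S &
    S `^ p <= 2 * 2 `^ (p^-1 - 1) * A].
Proof.
move=> p01 hu uA; have [p0 p1] := andP p01.
have cu r : r < 1 -> circle_continuous r u.
  move=> r1 w wr; have [|D] := hu w; first by rewrite wr.
  exact: cdiff_continuous.
have h12 : 2^-1 < 1 :> R by rewrite invf_lt1// ltr1n.
pose V : set R :=
  [set (2^-1 - nc z) `^ p^-1 * nc (u z) | z in [set z | nc z < 2^-1]].
pose S := sup V.
have ubV : has_ubound V.
  exists (2 * (3 * circle_avg_norm (3 / 4) u)) => _ [z /= zs <-].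
  have z0 := normc_ge0 z.
  have w1 : (2^-1 - nc z) `^ p^-1 <= 1.
    apply: (@le_trans _ _ (1 `^ p^-1)); last by rewrite powR1.
    rewrite ge0_ler_powR ?nnegrE ?invr_ge0 ?(ltW p0)//; lra.
  have z34 : nc z < 3 / 4 by lra.
  apply: (@le_trans _ _ (nc (u z))).
    by rewrite -[leRHS]mul1r ler_wpM2r ?normc_ge0.
  have r1 : 3 / 4 < 1 :> R by lra.
  apply: (le_trans (normc_le_circle_avg hu z34 r1)).
  rewrite ler_wpM2l// ler_wpM2r ?circle_avg_norm_ge0// ler_pdivrMr; lra.
have neV : V !=set0.
  exists ((2^-1 - nc (0 : Cplx R)) `^ p^-1 * nc (u 0)); exists 0 => //.
  by change (nc (0 : Cplx R) < 2^-1); rewrite Normc.normc0 invr_gt0.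
have VS z : nc z < 2^-1 -> (2^-1 - nc z) `^ p^-1 * nc (u z) <= S.
  by move=> zs; apply: ub_le_sup => //; exists z.
have S0 : 0 <= S.
  apply: le_trans (VS 0 _); last by rewrite Normc.normc0.
  by rewrite mulr_ge0 ?powR_ge0 ?normc_ge0.
have A0 : 0 <= A.
  apply: le_trans (uA 2^-1 _); last by rewrite h12 invr_gt0 ltr0n.
  rewrite divr_ge0 ?(ltW pi2_gt0)//; apply: Rintegral_ge0 => t _; exact: powR_ge0.
pose al := p^-1 - 1.
have al0 : 0 < al by rewrite subr_gt0 invf_gt1.
have key z : nc z < 2^-1 -> (2^-1 - nc z) `^ p^-1 * nc (u z) <=
    2 * 2 `^ al * A * S `^ (1 - p).
  move=> zs; have z0 := normc_ge0 z.
  pose d := 2^-1 - nc z; have d0 : 0 < d by rewrite subr_gt0.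
  pose rho := nc z + d / 2.
  have rho0 : 0 < rho by rewrite /rho ltr_wpDl// divr_gt0.
  have rho1 : rho < 2^-1 by rewrite /rho /d; lra.
  have zrho : nc z < rho by rewrite /rho ltrDl divr_gt0.
  have rho_1 : rho < 1 by lra.
  have bd w : nc w = rho -> nc (u w) <= S / (d / 2) `^ p^-1.
    move=> wr; rewrite ler_pdivlMr ?powR_gt0 ?divr_gt0// mulrC.
    have := VS w; rewrite wr (_ : 2^-1 - rho = d / 2); first by apply.
    by rewrite /rho /d; field.
  have := circle_avg_norm_power_mean p01 (ltW rho0) (cu _ rho_1) bd.
  have pm : power_mean p u rho <= A by apply: uA; rewrite rho0.
  move=> /le_trans /(_ (ler_wpM2l (powR_ge0 _ _) pm)) avg.
  have h := normc_le_circle_avg hu zrho rho_1.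
  have hB : (S / (d / 2) `^ p^-1) `^ (1 - p) = S `^ (1 - p) * (2 `^ al / d `^ al).
    rewrite powRM ?invr_ge0 ?powR_ge0//; congr (_ * _).
    rewrite -powRN -powRrM.
    have -> : - p^-1 * (1 - p) = - al.
      by rewrite /al mulrBr mulr1 mulNr mulVf ?gt_eqF// opprK opprB addrC.
    rewrite powRN powRM ?invr_ge0 ?(ltW d0)// invfM mulrC; congr (_ / _).
    by rewrite -[2^-1]powR_inv1// -powRrM mulN1r powRN invrK.
  have dp : d `^ p^-1 = d * d `^ al.
    by rewrite mulr_powRB1 ?(ltW d0)// invr_gt0.
  have dal : 0 < d `^ al by rewrite powR_gt0.
  rewrite -/d dp.
  have k1 : rho / (rho - nc z) <= d^-1.
    rewrite ler_pdivrMr ?subr_gt0// /rho addrAC subrr add0r mulrA mulVf ?gt_eqF// mul1r.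
    by rewrite -/rho ltW.
  apply: (@le_trans _ _ (d * d `^ al * (2 * (d^-1 *
     (S `^ (1 - p) * (2 `^ al / d `^ al) * A))))).
    rewrite ler_wpM2l ?mulr_ge0 ?(ltW d0) ?(ltW dal)//.
    apply: (le_trans h); rewrite ler_wpM2l// -hB ler_pM//.
    - by rewrite divr_ge0 ?(ltW rho0)// subr_ge0 ltW.
    - exact: circle_avg_norm_ge0.
  move: dal; move: (d `^ al) (2 `^ al) (S `^ (1 - p)) => x y v x0.
  have -> : d * x * (2 * (d^-1 * (v * (y / x) * A))) = 2 * y * A * v.
    by field; rewrite !gt_eqF.
  exact: lexx.
exists S; split => //.
have SS : S <= 2 * 2 `^ al * A * S `^ (1 - p).
  by apply: ge_sup => // _ [z /= zs <-]; exact: key.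
have [S00|Sn0] := eqVneq S 0.
  by rewrite S00 powR0 ?gt_eqF// !mulr_ge0// powR_ge0.
have Sp : 0 < S by rewrite lt_def Sn0.
have S1 : 0 < S `^ (1 - p) by rewrite powR_gt0.
rewrite -(ler_pM2r S1) -powRD; last by rewrite Sn0 implybT.
by rewrite addrC subrK powRr1.
Qed.

Lemma taylor_coef_power_mean p k : 0 < p < 1 -> exists C : R, 0 < C /\
  forall u A, (forall z, nc z < 1 -> exists D, cdiff u z D) ->
    (forall r, 0 < r < 1 -> power_mean p u r <= A) ->
    nc (taylor_coef u k) `^ p <= C * A.
Proof.
move=> p01; have [p0 p1] := andP p01.
have q0 : (0 : R) < 4^-1 by rewrite invr_gt0.
have q1 : 4^-1 < 1 :> R by rewrite invf_lt1// ltr1n.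
pose L : R := 2 * (4^-1 ^- k * 4 `^ p^-1).
have L0 : 0 < L by rewrite mulr_gt0// mulr_gt0 ?powR_gt0// invr_gt0 exprn_gt0.
exists (L `^ p * (2 * 2 `^ (p^-1 - 1))); split.
  by rewrite mulr_gt0 ?powR_gt0// mulr_gt0// powR_gt0.
move=> u A hu uA; have [S [S0 SP SA]] := weighted_sup_bound p01 hu uA.
have cu : circle_continuous (4^-1 : R) u.
  move=> w wr; have [|D] := hu w; first by rewrite wr.
  exact: cdiff_continuous.
have uS w : nc w = 4^-1 -> nc (u w) <= 4 `^ p^-1 * S.
  have h4 : 4^-1 < 2^-1 :> R by rewrite ltf_pV2 ?posrE// ltr_nat.
  move=> wr; have := SP w; rewrite wr => /(_ h4).
  rewrite (_ : 2^-1 - 4^-1 = 4^-1); last by field.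
  by rewrite -[4^-1]powR_inv1// -powRrM mulN1r powRN ler_pdivrMl ?powR_gt0.
have cL : nc (taylor_coef u k) <= L * S.
  rewrite (taylor_coef_cauchy k q0 q1 hu).
  apply: (le_trans (normc_cauchy_coef hu k q0 q1)).
  rewrite /L -!mulrA ler_wpM2l// ler_wpM2l ?invr_ge0 ?exprn_ge0 ?(ltW q0)//.
  have S4 : 0 <= 4 `^ p^-1 * S by rewrite mulr_ge0 ?powR_ge0.
  pose c : Cplx R := ((4 `^ p^-1 * S)%:C)%C.
  have cE : nc c = 4 `^ p^-1 * S by rewrite normcr ger0_norm.
  rewrite -cE -(circle_avg_norm_cst c (ltW q0)).
  apply: (circle_avg_norm_le (ltW q0) cu) => [v _|v vr].
    exact: continuous_Cplx_cst.
  by rewrite cE uS.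
apply: (@le_trans _ _ ((L * S) `^ p)).
  rewrite ge0_ler_powR ?nnegrE ?normc_ge0 ?(ltW p0)//.
  by rewrite mulr_ge0// ltW.
rewrite powRM ?(ltW L0)// -[leRHS]mulrA.
by apply: ler_wpM2l; [exact: powR_ge0|exact: SA].
Qed.

End PowerMeans.

(** * The power series with harmonic coefficients *)

Section HarmonicSeries.
Context {R : realType}.
Implicit Types (z w : Cplx R) (r s e q d x : R).

Definition harm n : R := \sum_(i < n) i.+1%:R^-1.

Lemma harmS n : harm n.+1 = harm n + n.+1%:R^-1.
Proof. by rewrite /harm big_ord_recr. Qed.

Lemma harm_ge0 n : 0 <= harm n.
Proof. by rewrite /harm sumr_ge0// => i _; rewrite invr_ge0. Qed.

Lemma harm_le n m : (n <= m)%N -> harm n <= harm m.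
Proof.
move=> /subnKC <-; elim: (m - n)%N => [|k ih]; first by rewrite addn0.
by rewrite addnS harmS (le_trans ih)// lerDl invr_ge0.
Qed.

Lemma harm_le_nat n : harm n <= n%:R.
Proof.
rewrite -[n in n%:R]card_ord -sum1_card natr_sum; apply: ler_sum => i _.
by rewrite invf_le1 ?ltr0Sn// ler1n.
Qed.

Lemma harm_le_ln n : harm n.+1 <= 1 + ln n.+1%:R.
Proof.
elim: n => [|n ih]; first by rewrite harmS /harm big_ord0 ln1 add0r addr0 invr1.
rewrite harmS.
have p1 : 0 < n.+1%:R :> R by rewrite ltr0n.
have p2 : 0 < n.+2%:R :> R by rewrite ltr0n.
have h : ln (1 + - n.+2%:R^-1) <= - n.+2%:R^-1 :> R.
  by apply: le_ln1Dx; rewrite ltrN2 invf_lt1// ltr1n.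
have e1 : 1 + - n.+2%:R^-1 = n.+1%:R / n.+2%:R :> R.
  have -> : n.+1%:R = n.+2%:R - 1 :> R by rewrite -[n.+2%:R]natr1 addrK.
  by rewrite mulrBl divff ?mul1r// gt_eqF.
move: h; rewrite e1 ln_div ?posrE// lerBlDr => h.
by rewrite (le_trans (lerD ih (lexx _)))// -addrA lerD2l -lerBrDr addrC.
Qed.

Lemma unbounded_harm (B : R) : exists k, B < harm k.
Proof.
apply: contrapT => /forallNP hB; apply: (@dvg_harmonic R).
apply: nondecreasing_is_cvgn.
  by apply: nondecreasing_series => i _ _; rewrite invr_ge0.
exists B => _ [n _ <-]; rewrite /= /series /= big_mkord leNgt; apply/negP; exact: hB.
Qed.

Definition harm_coef k : Cplx R := ((harm k)%:C)%C.

Lemma radius_harm : radius_ge harm_coef 1.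
Proof.
move=> s s0 s1; exists (1 - s)^-1 => k.
rewrite normcr (ger0_norm (harm_ge0 k)) -[leRHS]mul1r ler_pdivlMr ?subr_gt0//.
apply: le_trans (_ : 1 - s ^+ k <= 1); last by rewrite gerBl exprn_ge0// ltW.
apply: le_trans (natmul_geometric k (q := s) _); last by rewrite !ltW.
by rewrite !ler_wpM2r ?subr_ge0 ?(ltW s1) ?exprn_ge0 ?(ltW s0)// harm_le_nat.
Qed.

Definition harm_fun z : Cplx R :=
  if pselect (nc z < 1) is left zr then sval (cid (power_sum_ex radius_harm zr))
  else 0.

Lemma harm_fun_sum z : nc z < 1 -> power_sum harm_coef z (harm_fun z).
Proof.
by move=> z1; rewrite /harm_fun; case: pselect => // zr; case: cid.
Qed.

Lemma harm_fun_out z : ~ nc z < 1 -> harm_fun z = 0.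
Proof. by rewrite /harm_fun; case: pselect. Qed.

Lemma cdiff_harm_fun z : nc z < 1 -> exists D, cdiff harm_fun z D.
Proof.
move=> z1; have [L hL] := power_sum_ex (radius_ge_deriv radius_harm) z1.
by exists L; apply: (cdiff_power_sum radius_harm _ z1 hL) => w; exact: harm_fun_sum.
Qed.

Lemma taylor_coef_harm_fun k : taylor_coef harm_fun k = harm_coef k.
Proof.
apply: (taylor_coef_power_sum k ltr01 radius_harm) => w; exact: harm_fun_sum.
Qed.

Definition log_term z i : Cplx R := (i.+1%:R^-1%:C)%C * z ^+ i.+1.
Definition log_sum z n : Cplx R := \sum_(i < n) log_term z i.

(** Multiplying by [1 - z] replaces the harmonic numbers by their increments,
    which are the coefficients of [- ln (1 - z)]. *)
Lemma psum_harm z n : (1 - z) * psum harm_coef n.+1 z =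
  log_sum z n - harm_coef n * z ^+ n.+1.
Proof.
rewrite /psum /log_sum; elim: n => [|n ih].
  rewrite big_ord_recr !big_ord0 /= /harm_coef /harm big_ord0 !mul0r addr0.
  by rewrite mulr0 subr0.
rewrite big_ord_recr /= mulrDr ih big_ord_recr /= /log_term.
have -> : harm_coef n.+1 = harm_coef n + ((n.+1%:R^-1)%:C)%C.
  by rewrite /harm_coef harmS rmorphD.
by rewrite [z ^+ n.+2]exprS; ring.
Qed.

(** Summation by parts, the coefficients [1 / (i + 1)] being decreasing. *)
Lemma log_block z N m : nc z < 1 ->
  nc ((1 - z) * \sum_(i < m) log_term z (N + i)) <= 2 / N.+1%:R.
Proof.
move=> z1; pose c i : R := (N + i).+1%:R^-1.
have c0 i : 0 <= c i by rewrite invr_ge0.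
have zk k : nc z ^+ k <= 1 by rewrite exprn_ile1 ?normc_ge0// ltW.
case: m => [|m].
  by rewrite big_ord0 mulr0 Normc.normc0 divr_ge0.
have cS i : c i.+1 <= c i by rewrite lef_pV2 ?posrE ?ltr0n// ler_nat addnS.
have key : nc ((1 - z) * (\sum_(i < m.+1) log_term z (N + i)) +
    (c m)%:C%C * z ^+ (N + m).+2) <= 2 * c 0%N - c m.
  elim: m => [|m ih].
    rewrite big_ord_recr big_ord0 /= add0r /log_term -/(c 0%N).
    have -> : (1 - z) * ((c 0%N)%:C%C * z ^+ (N + 0).+1) + (c 0%N)%:C%C * z ^+ (N + 0).+2
        = (c 0%N)%:C%C * z ^+ (N + 0).+1 by rewrite [z ^+ _.+2]exprS; ring.
    rewrite normc_mul normcr ger0_norm// normc_exp.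
    have -> : 2 * c 0%N - c 0%N = c 0%N by ring.
    by rewrite ler_piMr.
  rewrite big_ord_recr /= {2}/log_term -/(c m.+1).
  have -> : (1 - z) * (\sum_(i < m.+1) log_term z (N + i) +
      (c m.+1)%:C%C * z ^+ (N + m.+1).+1) + (c m.+1)%:C%C * z ^+ (N + m.+1).+2 =
    ((1 - z) * (\sum_(i < m.+1) log_term z (N + i)) +
      (c m)%:C%C * z ^+ (N + m).+2) + ((c m.+1 - c m)%:C)%C * z ^+ (N + m).+2.
    by rewrite rmorphB /= addnS [z ^+ (N + m).+3]exprS; ring.
  apply: (le_trans (ler_normcD _ _)).
  have h : nc (((c m.+1 - c m)%:C)%C * z ^+ (N + m).+2) <= c m - c m.+1.
    rewrite normc_mul normcr distrC ger0_norm ?subr_ge0// normc_exp ler_piMr// subr_ge0//.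
  by move: ih h; set a := nc _; set b := nc _; lra.
have h : nc ((c m)%:C%C * z ^+ (N + m).+2) <= c m.
  by rewrite normc_mul normcr ger0_norm// normc_exp ler_piMr.
have -> : 2 / N.+1%:R = 2 * c 0%N by rewrite /c addn0.
have := ler_normcD ((1 - z) * (\sum_(i < m.+1) log_term z (N + i)) +
    (c m)%:C%C * z ^+ (N + m).+2) (- ((c m)%:C%C * z ^+ (N + m).+2)).
by rewrite addrK normc_opp => /le_trans; apply; lra.
Qed.

Lemma normc_log_sum_harm z n : nc z < 1 -> nc (log_sum z n) <= harm n.
Proof.
move=> z1; apply: (le_trans (ler_normc_sum _ _ _)); apply: ler_sum => i _.
rewrite normc_mul normcr normc_exp ger0_norm ?invr_ge0//.
by rewrite ler_piMr ?invr_ge0// exprn_ile1 ?normc_ge0// ltW.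
Qed.

(** Cut the sum at [N] close to [1 / |1 - z|]. The terms before [N] add up to at
    most [1 + ln N], those after [N] to a constant by [log_block], and
    [ln N <= N^d / d]. *)
Lemma normc_log_sum z n d : nc z < 1 -> 0 < d ->
  nc (log_sum z n) <= (3 + d^-1) * 3 `^ d * nc (1 - z) `^ (- d).
Proof.
move=> z1 d0.
have y0 : 0 < nc (1 - z).
  by have := lerB_normcD 1 (- z); rewrite normc_opp Normc.normc1; lra.
have y2 : nc (1 - z) <= 2.
  by have := ler_normcD 1 (- z); rewrite normc_opp Normc.normc1; lra.
pose x := (nc (1 - z))^-1; have x0 : 0 < x by rewrite invr_gt0.
have x12 : 2^-1 <= x by rewrite lef_pV2 ?posrE.
pose N := Num.truncn x.
have /andP[N1 N2] : N%:R <= x < N.+1%:R by apply: truncn_itv; exact: ltW.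
have N3 : N.+1%:R <= 3 * x by rewrite -natr1; lra.
have main : nc (log_sum z n) <= harm N.+1 + 2.
  have [nN|Nn] := leqP n N.+1.
    apply: (le_trans (normc_log_sum_harm n z1)).
    by apply: (le_trans (harm_le nN)); rewrite lerDl.
  rewrite /log_sum -(subnKC (ltnW Nn)) big_split_ord /=.
  apply: (le_trans (ler_normcD _ _)); apply: lerD.
    exact: (normc_log_sum_harm N.+1 z1).
  have := log_block N.+1 (n - N.+1) z1; rewrite normc_mul => h.
  have {}h : nc (\sum_(i < n - N.+1) log_term z (N.+1 + i)) <= 2 / N.+2%:R * x.
    by rewrite ler_pdivlMr// mulrC.
  apply: (le_trans h); rewrite mulrAC ler_pdivrMr ?ltr0n// ler_pM2l//.
  by rewrite (le_trans (ltW N2))// ler_nat.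
have N0 : 0 < N.+1%:R :> R by rewrite ltr0n.
have Nd : 1 <= N.+1%:R `^ d :> R.
  by rewrite -[leLHS](powRr0 N.+1%:R) ler_powR ?ler1n// ltW.
have lnN : ln N.+1%:R <= d^-1 * N.+1%:R `^ d :> R.
  have := ln_sublinear (powR_gt0 d N0); rewrite ln_powR => /ltW.
  by rewrite -ler_pdivlMl.
have step : nc (log_sum z n) <= (3 + d^-1) * N.+1%:R `^ d.
  by apply: (le_trans main); have := harm_le_ln N; lra.
apply: (le_trans step); rewrite -mulrA ler_wpM2l ?addr_ge0 ?invr_ge0 ?(ltW d0)//.
have -> : nc (1 - z) `^ (- d) = x `^ d.
  by rewrite /x -powR_inv1 ?normc_ge0// -powRrM mulN1r.
rewrite -powRM ?(ltW x0)//.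
by rewrite ge0_ler_powR ?nnegrE ?(ltW d0) ?(ltW N0)// mulr_ge0// ltW.
Qed.

(** [(1 - z) h(z)] is the limit of the partial sums [log_sum], since the
    correction [H_n z^(n+1)] in [psum_harm] tends to [0]. *)
Lemma normc_harm_fun z d : nc z < 1 -> 0 < d ->
  nc (harm_fun z) <= (3 + d^-1) * 3 `^ d * nc (1 - z) `^ (- (1 + d)).
Proof.
move=> z1 d0.
have y0 : 0 < nc (1 - z).
  by have := lerB_normcD 1 (- z); rewrite normc_opp Normc.normc1; lra.
have y2 : nc (1 - z) <= 2.
  by have := ler_normcD 1 (- z); rewrite normc_opp Normc.normc1; lra.
set B := _ * 3 `^ d.
have -> : nc (1 - z) `^ (- (1 + d)) = (nc (1 - z))^-1 * nc (1 - z) `^ (- d).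
  rewrite opprD powRD; last by rewrite (gt_eqF y0) implybT.
  by rewrite powR_inv1 ?(ltW y0).
rewrite mulrCA -ler_pdivrMl ?invr_gt0// invrK.
apply/ler_addgt0Pl => e e0.
have z0 := normc_ge0 z.
pose s := (1 + nc z) / 2.
have s0 : 0 < s by rewrite /s; lra.
have s1 : s < 1 by rewrite /s; lra.
have zs : nc z < s by rewrite /s; lra.
clearbody s.
have [C CP] := radius_harm s0 s1.
have C0 : 0 <= C by apply: le_trans (CP 0%N); rewrite expr0 mulr1 normc_ge0.
have e40 : 0 < e / 4 by rewrite divr_gt0.
have [N1 h1] := harm_fun_sum z1 e40.
have q0 : 0 <= nc z / s by rewrite divr_ge0// ltW.
have q1 : `|nc z / s| < 1 by rewrite (ger0_norm q0) ltr_pdivrMr// mul1r.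
have K1 : 0 < e / 4 / (C + 1) by rewrite divr_gt0// ltr_wpDl.
have /cvgrPdist_le/(_ _ K1)[N2 _ h2] := cvg_expr q1.
pose n := maxn N1 N2.
have {}h1 := h1 n.+1 (leqW (leq_maxl _ _)).
have {}h2 := h2 n (leq_maxr _ _).
have h3 : nc (harm_coef n * z ^+ n.+1) <= e / 4.
  rewrite normc_mul normc_exp exprSr mulrA.
  apply: (@le_trans _ _ (nc (harm_coef n) * nc z ^+ n)).
    by rewrite ler_piMr ?mulr_ge0 ?normc_ge0 ?exprn_ge0// ltW.
  have -> : nc z ^+ n = s ^+ n * (nc z / s) ^+ n.
    by rewrite expr_div_n [RHS]mulrC divfK// expf_neq0// gt_eqF.
  rewrite mulrA; move: h2; rewrite sub0r normrN ger0_norm; last first.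
    exact: exprn_ge0.
  move=> h2; apply: (le_trans (ler_pM _ _ (CP n) h2)).
  - by rewrite mulr_ge0 ?normc_ge0 ?exprn_ge0// ltW.
  - exact: exprn_ge0.
  by rewrite mulrCA ger_pMr// ler_pdivrMr ?ltr_wpDl// mul1r lerDl.
have h4 := normc_log_sum n z1 d0.
have -> : nc (1 - z) * nc (harm_fun z) =
    nc (log_sum z n - harm_coef n * z ^+ n.+1
        - (1 - z) * (psum harm_coef n.+1 z - harm_fun z)).
  by rewrite -psum_harm -mulrBr subKr normc_mul.
apply: (le_trans (ler_normcD _ _)); rewrite normc_opp normc_mul.
have h5 := ler_normcD (log_sum z n) (- (harm_coef n * z ^+ n.+1)).
rewrite normc_opp in h5.
have h6 : nc (1 - z) * nc (psum harm_coef n.+1 z - harm_fun z) <= 2 * (e / 4).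
  by rewrite ler_pM ?normc_ge0.
rewrite -/B in h4; move: h3 h4 h5 h6; lra.
Qed.

End HarmonicSeries.

Section HarmonicMeans.
Context {R : realType}.
Implicit Types (r s t u x d q e : R).
Local Notation pi2 := (2 * pi : R).

(** By the mean value theorem on [[0, u / 2]], where the cosine is at least
    [cos (pi / 4)], and [sin u = 2 sin (u / 2) cos (u / 2)]. *)
Lemma sin_ge_half u : 0 <= u <= pi / 2 -> u / 2 <= sin u.
Proof.
move=> /andP[u0 u1]; have p0 := @pi_gt0 R.
have [->|un0] := eqVneq u 0; first by rewrite sin0 mul0r.
have {un0}u0 : 0 < u by rewrite lt_def un0.
pose a : R := cos (pi / 4).
have a0 : 0 < a by apply: cos_gt0_pihalf; lra.
have a2 : a ^+ 2 = 2^-1.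
  have := cos_pihalf R; rewrite (_ : pi / 2 = (pi / 4) *+ 2); last by field.
  by rewrite cos_mulr2n -/a; lra.
have cosa x : 0 <= x <= pi / 4 -> a <= cos x.
  move=> hx; rewrite leNgt; apply/negP => h.
  have : pi / 4 < x by rewrite -ltr_cos; [exact: h|rewrite in_itv/=; lra..].
  by case/andP: hx => _; rewrite leNgt => /negP.
have uh : u = (u / 2) *+ 2 by field.
have h2 : (0 : R) < u / 2 by lra.
have [c] := @MVT R sin cos 0 (u / 2) h2 (fun x _ => is_derive_sin x)
  ltac:(by apply: continuous_subspaceT; exact: continuous_sin).
rewrite in_itv/= sin0 !subr0 => hc hs.
have ca : a <= cos c by apply: cosa; lra.
have cu : a <= cos (u / 2) by apply: cosa; lra.
have su : a * (u / 2) <= sin (u / 2) by rewrite hs ler_wpM2r// ltW.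
have -> : sin u = cos (u / 2) * sin (u / 2) *+ 2 by rewrite -sin_mulr2n -uh.
have : a * (a * (u / 2)) <= cos (u / 2) * sin (u / 2).
  by rewrite ler_pM// ?(ltW a0)// mulr_ge0 ?(ltW a0)// ltW.
by rewrite mulrA -expr2 a2; lra.
Qed.

Lemma normc_one_sub_circle_sqr r t :
  nc (1 - circle_point r t) ^+ 2 = 1 - 2 * r * cos t + r ^+ 2.
Proof.
rewrite normc_sqr /= sub0r; have := cos2Dsin2 t => h.
rewrite sqrrN exprMn; have -> : sin t ^+ 2 = 1 - cos t ^+ 2 by lra.
by ring.
Qed.

(** The modulus is at least the distance [1 - r] to the unit circle, and at least
    [sin (t / 2) >= t / 4]. Adding the two bounds keeps the lower bound positive
    at [t = 0], so that the later integrals are not singular. *)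
Lemma normc_one_sub_circle_ge r t : 0 <= r < 1 -> 0 <= t <= pi ->
  ((1 - r) + t) / 5 <= nc (1 - circle_point r t).
Proof.
move=> /andP[r0 r1] /andP[t0 t1].
have n0 := normc_ge0 (1 - circle_point r t).
have h1 : 1 - r <= nc (1 - circle_point r t).
  have := lerB_normcD 1 (- circle_point r t).
  by rewrite normc_opp Normc.normc1 normc_circle_point ger0_norm.
pose s : R := sin (t / 2).
have sge : t / 2 / 2 <= s by apply: sin_ge_half; lra.
have s0 : 0 <= s by apply: le_trans sge; lra.
have s1 : s ^+ 2 <= 1.
  by have := cos2Dsin2 (t / 2); have := sqr_ge0 (cos (t / 2)); rewrite -/s; lra.
have ct : cos t = 1 - 2 * s ^+ 2.
  rewrite {1}(_ : t = (t / 2) *+ 2); last by field.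
  by rewrite cos_mulr2n cos2sin2 -/s; ring.
have h2 : s <= nc (1 - circle_point r t).
  rewrite -(@ler_pXn2r _ 2)// ?nnegrE// normc_one_sub_circle_sqr ct.
  have := sqr_ge0 s; set y := s ^+ 2 in s1 * => y0.
  have [r4|r4] := leP (1 / 4) r.
    have : 0 <= (4 * r - 1) * y by rewrite mulr_ge0//; lra.
    have := sqr_ge0 (1 - r); nra.
  have : 0 <= (1 - 4 * r) * (1 - y) by rewrite mulr_ge0//; lra.
  nra.
lra.
Qed.

Lemma normc_one_sub_circle_sym r t :
  nc (1 - circle_point r t) = nc (1 - circle_point r (pi2 - t)).
Proof.
have ct : cos (pi2 - t) = cos t.
  by rewrite addrC mulr_natl cosD2pi cosN.
apply/eqP; rewrite -(@eqrXn2 _ 2)// ?normc_ge0//.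
by rewrite !normc_one_sub_circle_sqr ct.
Qed.

Lemma is_derive_powR_affine (c k s t : R) : 0 < c + k * t ->
  is_derive t 1 (fun t => (c + k * t) `^ s) (s * (c + k * t) `^ (s - 1) * k).
Proof.
move=> ct; have d1 := is_derive1_powR s ct.
have d2 : is_derive t 1 (fun t => c + k * t) k.
  have := is_deriveD (is_derive_cst c t 1) (is_deriveZ k (is_derive_id t 1)).
  by rewrite add0r [k *: _]mulr1.
exact: (@is_derive1_comp R (@powR R ^~ s) (fun t => c + k * t) t _ _ d1 d2).
Qed.

(** An explicit primitive bounds the integral uniformly in the positive
    parameter [e], although the limit [e = 0] is singular at both ends. *)
Lemma itg_powR_ends e s : 0 < e -> e <= 1 -> 0 < s < 1 ->
  itgable 0 pi2 (fun t => (e + t) `^ (- s) + (e + (pi2 - t)) `^ (- s)) /\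
  itg 0 pi2 (fun t => (e + t) `^ (- s) + (e + (pi2 - t)) `^ (- s))
    <= 2 * (1 + pi2) `^ (1 - s) / (1 - s).
Proof.
move=> e0 e1 /andP[s0 s1]; have p0 : 0 < pi2 := pi2_gt0.
pose f t := (e + t) `^ (- s) + (e + (pi2 - t)) `^ (- s).
pose G t := ((e + t) `^ (1 - s) - (e + (pi2 - t)) `^ (1 - s)) / (1 - s).
have E1 (x : R) t : (e + t) `^ x = (e + 1 * t) `^ x by rewrite mul1r.
have E2 (x : R) t : (e + (pi2 - t)) `^ x = ((e + pi2) + (-1) * t) `^ x.
  by rewrite mulN1r addrA.
have dG t : 0 <= t <= pi2 -> is_derive t 1 G (f t).
  move=> ht.
  have p1 : 0 < e + 1 * t by lra.
  have p2 : 0 < (e + pi2) + (-1) * t by lra.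
  have d1 := @is_derive_powR_affine e 1 (1 - s) t p1.
  have d2 := @is_derive_powR_affine (e + pi2) (-1) (1 - s) t p2.
  have := is_deriveZ (1 - s)^-1 (is_deriveB d1 d2).
  have -> : (1 - s)^-1 \*: ((fun t => (e + 1 * t) `^ (1 - s)) -
      (fun t => (e + pi2 + -1 * t) `^ (1 - s))) = G.
    apply/funext => x; rewrite /G E1 E2; exact: mulrC.
  rewrite (_ : 1 - s - 1 = - s); last by ring.
  move=> [dGt dGv]; apply: DeriveDef; [exact: dGt|rewrite [LHS]dGv].
  have -> : f t = (e + 1 * t) `^ (- s) + (e + pi2 + -1 * t) `^ (- s) by rewrite /f E1 E2.
  rewrite /GRing.scale/=.
  move: (_ `^ (- s)) (_ `^ (- s)) => y1 y2; field.
  by rewrite subr_eq0 gt_eqF.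
have contf t : 0 <= t <= pi2 -> {for t, continuous f}.
  move=> ht.
  have p1 : 0 < e + 1 * t by lra.
  have p2 : 0 < (e + pi2) + (-1) * t by lra.
  have d1 := @is_derive_powR_affine e 1 (- s) t p1.
  have d2 := @is_derive_powR_affine (e + pi2) (-1) (- s) t p2.
  have fE : f = (fun t => (e + 1 * t) `^ (- s)) + (fun t => (e + pi2 + -1 * t) `^ (- s)).
    by apply/funext => x; rewrite /f E1 E2.
  rewrite fE; apply: differentiable_continuous; apply/derivable1_diffP.
  by case: (is_deriveD d1 d2).
have itf : itgable 0 pi2 f.
  by apply: itgable_continuous => t; rewrite in_itv/=; exact: contf.
have contG t : 0 <= t <= pi2 -> {for t, continuous G}.
  move=> /dG[dGt _]; apply: differentiable_continuous; exact/derivable1_diffP.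
split=> //.
have -> : itg 0 pi2 f = G pi2 - G 0.
  rewrite /itg /Rintegral (@continuous_FTC2 _ f G)//.
  - by apply: continuous_in_subspaceT => t /set_mem; rewrite /= in_itv/=; exact: contf.
  - split.
    + move=> t; rewrite in_itv/= => ht; have [|//] := dG t; lra.
    + by apply: cvg_at_right_filter; apply: contG; rewrite lexx ltW.
    + by apply: cvg_at_left_filter; apply: contG; rewrite lexx ltW.
  - move=> t; rewrite in_itv/= => ht.
    by have [|_ <-] := dG t; [lra|rewrite derive1E].
rewrite /G addr0 subr0 subrr addr0.
have h1 : (e + pi2) `^ (1 - s) <= (1 + pi2) `^ (1 - s).
  by rewrite ge0_ler_powR ?nnegrE ?subr_ge0 ?(ltW s1)//; lra.
have h2 := powR_ge0 e (1 - s).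
rewrite -mulrBl ler_pM2r ?invr_gt0 ?subr_gt0//; lra.
Qed.

(** With [d = 1 - q] the exponent [q (1 + d) = 1 - (1 - q)^2] is less than one. *)
Lemma power_mean_harm_fun q : 0 < q < 1 ->
  exists K, forall r, 0 < r < 1 -> power_mean q (@harm_fun R) r <= K.
Proof.
move=> /andP[q0 q1]; pose d := 1 - q; have d0 : 0 < d by rewrite subr_gt0.
pose C := (3 + d^-1) * 3 `^ d.
have C0 : 0 <= C by rewrite mulr_ge0 ?powR_ge0// addr_ge0// invr_ge0 ltW.
pose s := q * (1 + d).
have s0 : 0 < s by rewrite mulr_gt0// ltr_wpDl// ltW.
have s1 : s < 1.
  have : 0 < (1 - q) ^+ 2 by rewrite exprn_gt0.
  by rewrite /s /d; nra.
pose B := 2 * (1 + pi2) `^ (1 - s) / (1 - s).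
exists (C `^ q * 5 `^ s * B / pi2) => r /andP[r0 r1].
have e0 : 0 < 1 - r by rewrite subr_gt0.
have e1 : 1 - r <= 1 by lra.
have [itf itB] := itg_powR_ends e0 e1 (s := s) ltac:(by rewrite s0).
rewrite /power_mean ler_wpM2r ?invr_ge0 ?(ltW pi2_gt0)//.
apply: (@le_trans _ _ (itg 0 pi2 (fun t => C `^ q * 5 `^ s *
   (((1 - r) + t) `^ (- s) + ((1 - r) + (pi2 - t)) `^ (- s))))); last first.
  by rewrite itgZ// ler_wpM2l// mulr_ge0 ?powR_ge0.
apply: ler_itg; [|exact: itgableZ|].
  apply: itgable_power_mean; [exact: ltW|exact: ltW|].
  move=> w wr; have [|D] := @cdiff_harm_fun R w; first by rewrite wr.
  exact: cdiff_continuous.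
move=> t /andP[t0 t1].
have z1 : nc (circle_point r t) < 1 by rewrite normc_circle_point gtr0_norm.
have y0 : 0 < nc (1 - circle_point r t).
  by have := lerB_normcD 1 (- circle_point r t); rewrite normc_opp Normc.normc1; lra.
have h1 := normc_harm_fun z1 d0; rewrite -/C in h1.
apply: (@le_trans _ _ ((C * nc (1 - circle_point r t) `^ (- (1 + d))) `^ q)).
  rewrite ge0_ler_powR ?nnegrE ?normc_ge0 ?(ltW q0)//.
  by rewrite mulr_ge0// powR_ge0.
rewrite powRM ?powR_ge0// -mulrA ler_wpM2l ?powR_ge0//.
rewrite -powRrM mulNr [_ * q]mulrC -/s.
have main x : 0 < x -> x / 5 <= nc (1 - circle_point r t) ->
    nc (1 - circle_point r t) `^ (- s) <= 5 `^ s * x `^ (- s).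
  move=> x0 hx; rewrite !powRN -[5 `^ s]invrK -invfM.
  have -> : (5 `^ s)^-1 * x `^ s = (x / 5) `^ s.
    rewrite powRM ?invr_ge0 ?(ltW x0)// mulrC; congr (_ * _).
    by rewrite -[5^-1]powR_inv1// -powRrM mulN1r powRN.
  have x5 : 0 < x / 5 by rewrite divr_gt0.
  by rewrite lef_pV2 ?posrE ?powR_gt0// ge0_ler_powR ?nnegrE ?(ltW s0) ?(ltW x5) ?(ltW y0).
have a0 := powR_ge0 (1 - r + t) (- s).
have b0 := powR_ge0 (1 - r + (pi2 - t)) (- s).
have c0 := powR_ge0 5 s.
have rr : 0 <= r < 1 by rewrite (ltW r0).
rewrite mulrDr.
have [tpi|pit] := leP t pi.
  apply: (@le_trans _ _ (5 `^ s * (1 - r + t) `^ (- s))).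
    apply: main; first by rewrite ltr_pwDl.
    by apply: normc_one_sub_circle_ge => //; rewrite t0.
  by rewrite lerDl mulr_ge0.
apply: (@le_trans _ _ (5 `^ s * (1 - r + (pi2 - t)) `^ (- s))).
  apply: main; first by rewrite ltr_pwDl// subr_ge0.
  rewrite normc_one_sub_circle_sym; apply: normc_one_sub_circle_ge => //; lra.
by rewrite lerDr mulr_ge0.
Qed.

End HarmonicMeans.

(** * Hardy spaces and their intersection *)

Section HardySpaces.
Context {R : realType}.
Implicit Types (f g u : Cplx R -> Cplx R) (z w : Cplx R) (p r c : R).
Local Notation pi2 := (2 * pi : R).

Lemma unit_discE z : unit_disc z <-> nc z < 1.
Proof. by rewrite /unit_disc /= norm_normc (_ : 1 = (1%:C)%C)// ltcR. Qed.

Lemma holomorphic_cdiff f : holomorphic_on_disc f <->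
  (forall z, nc z < 1 -> exists D, cdiff f z D) /\ (forall z, ~ nc z < 1 -> f z = 0).
Proof.
split=> -[df f0]; split.
- move=> z /unit_discE /df dfz; exists ('D_1 f z); apply/cdiffP; exact/derivableP.
- by move=> z zr; apply: f0 => /unit_discE.
- by move=> z /unit_discE /df[D /cdiffP[]].
- by move=> z zr; apply: f0 => /unit_discE.
Qed.

Lemma cdiff_circle_continuous f r : r < 1 ->
  (forall z, nc z < 1 -> exists D, cdiff f z D) -> circle_continuous r f.
Proof.
move=> r1 hf w wr; have [|D] := hf w; first by rewrite wr.
exact: cdiff_continuous.
Qed.

Lemma circle_mean_power_mean p f r : 0 <= p -> 0 <= r ->
  circle_continuous r f -> circle_mean p f r = (power_mean p f r)%:E.
Proof.
move=> p0 r0 cf; have iP := itgable_power_mean p0 r0 cf.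
rewrite /circle_mean /power_mean muleC EFinM; congr (_ * _)%E.
by rewrite /itg /Rintegral fineK//; exact: (integrable_fin_num _ iP).
Qed.

Lemma power_mean_ge0 p f r : 0 <= power_mean p f r.
Proof.
rewrite divr_ge0 ?(ltW pi2_gt0)//; apply: Rintegral_ge0 => t _; exact: powR_ge0.
Qed.

Lemma hardy_sup_le p f K : 0 < p ->
  (forall z, nc z < 1 -> exists D, cdiff f z D) ->
  (forall r, 0 < r < 1 -> power_mean p f r <= K) -> (hardy_sup p f <= K%:E)%E.
Proof.
move=> p0 hf fK; apply: ge_ereal_sup => _ [r + <-].
rewrite /= in_itv/= => /[dup] /andP[r0 r1] r01.
rewrite circle_mean_power_mean ?(ltW p0) ?(ltW r0)//; last exact: cdiff_circle_continuous.
by rewrite lee_fin fK.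
Qed.

Lemma power_mean_le_sup p f r : 0 < p -> 0 < r < 1 ->
  (forall z, nc z < 1 -> exists D, cdiff f z D) -> 
  ((power_mean p f r)%:E <= hardy_sup p f)%E.
Proof.
move=> p0 /[dup] /andP[r0 r1] r01 hf; apply: ereal_sup_ubound; exists r.
  by rewrite /= in_itv.
apply: circle_mean_power_mean; [exact: ltW|exact: ltW|exact: cdiff_circle_continuous].
Qed.

(** The means of a function that is continuous on circles are finite, so the
    conditions on the extended reals in the definition of [hardy] amount to one
    real bound. *)
Lemma hardyP p f : 0 < p -> hardy p f <-> holomorphic_on_disc f /\
  exists K, forall r, 0 < r < 1 -> power_mean p f r <= K.
Proof.
move=> p0; split=> -[/[dup] holf /holomorphic_cdiff[hf _]] hK; split=> //.
- exists (fine (hardy_sup p f)) => r r01.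
  have h := power_mean_le_sup p0 r01 hf.
  rewrite -lee_fin fineK// ge0_fin_numE//.
  by apply: le_trans h; rewrite lee_fin power_mean_ge0.
- by have [K fK] := hK; apply: le_lt_trans (hardy_sup_le p0 hf fK) (ltry _).
Qed.

Lemma power_mean_le_dist p f g r : 0 < p -> hardy p (f \- g) -> 0 < r < 1 ->
  power_mean p (f \- g) r <= hardy_dist p f g.
Proof.
move=> p0 [/holomorphic_cdiff[hf _] fin] r01.
have h := power_mean_le_sup p0 r01 hf.
rewrite -lee_fin fineK// ge0_fin_numE//.
by apply: le_trans h; rewrite lee_fin power_mean_ge0.
Qed.

Lemma hardy_dist_ge0 p f g : 0 <= hardy_dist p f g.
Proof.
apply: fine_ge0; apply: (@le_trans _ _ (circle_mean p (f \- g) 2^-1)).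
  rewrite /circle_mean mule_ge0 ?lee_fin ?invr_ge0 ?(ltW pi2_gt0)//.
  by apply: integral_ge0 => t _; rewrite lee_fin powR_ge0.
apply: ereal_sup_ubound; exists 2^-1 => //=; rewrite in_itv/=.
by rewrite invr_gt0 ltr0n invf_lt1// ltr1n.
Qed.

Lemma hardy_dist_le p f g K : 0 < p -> holomorphic_on_disc (f \- g) ->
  (forall r, 0 < r < 1 -> power_mean p (f \- g) r <= K) -> hardy_dist p f g <= K.
Proof.
move=> p0 /holomorphic_cdiff[hf _] fK.
have h := hardy_sup_le p0 hf fK.
have h12 : 0 < (2^-1 : R) < 1 by rewrite invr_gt0 ltr0n invf_lt1// ltr1n.
have h0 := power_mean_le_sup p0 h12 hf.
rewrite -lee_fin fineK// ge0_fin_numE; first exact: le_lt_trans h (ltry _).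
by apply: le_trans h0; rewrite lee_fin power_mean_ge0.
Qed.

Lemma power_meanZ p c f r : 0 <= p -> 0 <= r -> circle_continuous r f ->
  power_mean p (fun z => (c%:C)%C * f z) r = `|c| `^ p * power_mean p f r.
Proof.
move=> p0 r0 cf; rewrite /power_mean mulrA -itgZ; last exact: itgable_power_mean.
congr (_ / _); apply: eq_itg => t _.
by rewrite normc_mul normcr powRM// normc_ge0.
Qed.

Lemma holomorphicD f g : holomorphic_on_disc f -> holomorphic_on_disc g ->
  holomorphic_on_disc (f \+ g).
Proof.
move=> /holomorphic_cdiff[hf f0] /holomorphic_cdiff[hg g0].
apply/holomorphic_cdiff; split=> z zr; last by rewrite /= f0// g0// addr0.
have [a da] := hf z zr; have [b db] := hg z zr.
exists (a - (-1) * b).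
have -> : f \+ g = fun w => f w - (-1) * g w.
  by apply/funext => w; rewrite /= mulN1r opprK.
by apply: cdiffB => //; exact: cdiffZ.
Qed.

Lemma holomorphicZ (c : Cplx R) f : holomorphic_on_disc f ->
  holomorphic_on_disc (fun z => c * f z).
Proof.
move=> /holomorphic_cdiff[hf f0].
apply/holomorphic_cdiff; split=> z zr; last by rewrite f0// mulr0.
by have [a da] := hf z zr; exists (c * a); exact: cdiffZ.
Qed.

Lemma hardyZ p c f : 0 < p -> hardy p f -> hardy p (fun z => (c%:C)%C * f z).
Proof.
move=> p0 /(hardyP _ p0)[holf [K fK]]; apply/(hardyP _ p0); split.
  exact: holomorphicZ.
exists (`|c| `^ p * K) => r /[dup] /andP[r0 r1] r01.
have [hf _] := (holomorphic_cdiff f).1 holf.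
rewrite power_meanZ ?(ltW p0) ?(ltW r0)//; last exact: cdiff_circle_continuous.
by rewrite ler_wpM2l ?powR_ge0// fK.
Qed.

Lemma powR_add_le p (a b : R) : 0 < p -> 0 <= a -> 0 <= b ->
  (a + b) `^ p <= 2 `^ p * (a `^ p + b `^ p).
Proof.
move=> p0 a0 b0.
wlog ab : a b a0 b0 / a <= b.
  by move=> wl; have [/wl|/ltW /wl] := leP a b; [|rewrite addrC [_ `^ p + _]addrC]; apply.
apply: (@le_trans _ _ ((2 * b) `^ p)).
  by rewrite ge0_ler_powR ?nnegrE ?(ltW p0) ?addr_ge0 ?mulr_ge0//; lra.
by rewrite powRM// ler_wpM2l ?powR_ge0// lerDr powR_ge0.
Qed.

Lemma hardyD p f g : 0 < p -> hardy p f -> hardy p g -> hardy p (f \+ g).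
Proof.
move=> p0 /(hardyP _ p0)[holf [K fK]] /(hardyP _ p0)[holg [L gL]].
apply/(hardyP _ p0); have holfg := holomorphicD holf holg; split => //.
exists (2 `^ p * (K + L)) => r /[dup] /andP[r0 r1] r01.
have [hf _] := (holomorphic_cdiff f).1 holf.
have [hg _] := (holomorphic_cdiff g).1 holg.
have [hfg _] := (holomorphic_cdiff _).1 holfg.
have iP u : (forall z, nc z < 1 -> exists D, cdiff u z D) ->
    itgable 0 pi2 (fun t => nc (u (circle_point r t)) `^ p).
  move=> hu; apply: itgable_power_mean; [exact: ltW|exact: ltW|].
  exact: cdiff_circle_continuous.
have {}fK := fK r r01; have {}gL := gL r r01.
apply: (@le_trans _ _ (2 `^ p * (power_mean p f r + power_mean p g r))); last first.
  by rewrite ler_wpM2l ?powR_ge0// lerD.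
rewrite /power_mean -mulrDl mulrA ler_wpM2r ?invr_ge0 ?(ltW pi2_gt0)//.
have iD := itgableD (iP f hf) (iP g hg).
rewrite -(itgD (iP f hf) (iP g hg)) -(itgZ _ iD).
apply: ler_itg; [exact: iP|exact: itgableZ|move=> t _].
apply: le_trans (powR_add_le p0 (normc_ge0 _) (normc_ge0 _)).
rewrite ge0_ler_powR ?nnegrE ?(ltW p0) ?addr_ge0 ?normc_ge0//.
exact: ler_normcD.
Qed.

Lemma hardyB p f g : 0 < p -> hardy p f -> hardy p g -> hardy p (f \- g).
Proof.
move=> p0 hf hg; have -> : f \- g = f \+ (fun z => ((-1)%:C)%C * g z).
  by apply/funext => z; rewrite /= rmorphN1 mulN1r.
exact: (hardyD p0 hf (hardyZ (-1) p0 hg)).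
Qed.

Lemma hardy_harm_fun p : 0 < p < 1 -> hardy p (@harm_fun R).
Proof.
move=> p01; have [p0 _] := andP p01; apply/(hardyP _ p0); split.
  apply/holomorphic_cdiff; split; [exact: cdiff_harm_fun|exact: harm_fun_out].
exact: power_mean_harm_fun.
Qed.

End HardySpaces.

Section Metric.
Context {R : realType}.
Implicit Types (f g : Cplx R -> Cplx R).
Variable p : nat -> R.

Let term f g n : R :=
  2 ^- n.+1 * (hardy_dist (p n) f g / (1 + hardy_dist (p n) f g)).

Let term_ge0 f g n : 0 <= term f g n.
Proof.
have d0 := hardy_dist_ge0 (p n) f g.
by rewrite mulr_ge0 ?invr_ge0 ?exprn_ge0// divr_ge0// addr_ge0.
Qed.

Let series_le f g N e m : 0 <= e ->
  (forall n, (n < N)%N -> hardy_dist (p n) f g <= e) ->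
  \sum_(n < m) term f g n <= e + 2 ^- N.
Proof.
move=> e0 de.
have half n : 2 ^- n = 2 ^- n.+1 + 2 ^- n.+1 :> R.
  by rewrite exprSr invfM; field.
have p2 n : 0 <= 2 ^- n :> R by rewrite invr_ge0 exprn_ge0.
have small n : (n < N)%N -> term f g n <= e * 2 ^- n.+1.
  move=> /de h; have d0 := hardy_dist_ge0 (p n) f g.
  rewrite /term mulrC ler_wpM2r// (le_trans _ h)// ler_pdivrMr ?ltr_wpDr//.
  by rewrite mulrDr mulr1 lerDl mulr_ge0.
have big n : term f g n <= 2 ^- n.+1.
  have d0 := hardy_dist_ge0 (p n) f g.
  by rewrite /term ler_piMr// ler_pdivrMr ?ltr_wpDr// mul1r lerDr.
have first m' : (m' <= N)%N -> \sum_(n < m') term f g n <= e * (1 - 2 ^- m').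
  elim: m' => [|k ih] kN; first by rewrite big_ord0 expr0 invr1 subrr mulr0.
  rewrite big_ord_recr /=; have := ih (ltnW kN); have := small k kN.
  by rewrite [2 ^- k]half; lra.
have rest k : \sum_(n < N + k) term f g n <= e * (1 - 2 ^- N) + (2 ^- N - 2 ^- (N + k)).
  elim: k => [|k ih]; first by rewrite addn0 subrr addr0 first.
  rewrite addnS big_ord_recr /=; have := big (N + k)%N; move: ih.
  by rewrite [2 ^- (N + k)]half; lra.
have eN : 0 <= e * 2 ^- N by rewrite mulr_ge0.
have [mN|/ltnW Nm] := leqP m N.
  have := first m mN; have : 0 <= e * 2 ^- m by rewrite mulr_ge0.
  by have := p2 N; lra.
by have := rest (m - N)%N; rewrite subnKC//; have := p2 m; lra.
Qed.

Let term_cvg f g : cvgn (series (term f g)).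
Proof.
apply: nondecreasing_is_cvgn.
  by apply: nondecreasing_series => n _ _; exact: term_ge0.
exists (0 + 2 ^- 0) => _ [m _ <-]; rewrite /= /series /= big_mkord.
by apply: series_le.
Qed.

(** The terms of index [N] and above contribute at most the sum of their weights. *)
Lemma hardy_cap_dist_le f g N e : 0 <= e ->
  (forall n, (n < N)%N -> hardy_dist (p n) f g <= e) ->
  hardy_cap_dist p f g <= e + 2 ^- N.
Proof.
move=> e0 de; apply: limr_le; first exact: term_cvg.
by near=> m; rewrite /series /= big_mkord; exact: series_le.
Unshelve. all: by end_near. Qed.

(** Compare with the first term of the series, of weight [1/2], and use that
    [x / (1 + x)] is increasing. *)
Lemma hardy_dist_lt f g e : 0 < e ->
  hardy_cap_dist p f g < 2^-1 * (e / (1 + e)) -> hardy_dist (p 0%N) f g < e.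
Proof.
move=> e0 h; have d0 := hardy_dist_ge0 (p 0%N) f g.
have : term f g 0%N <= hardy_cap_dist p f g.
  have nd : nondecreasing_seq (series (term f g)).
    by apply: nondecreasing_series => n _ _; exact: term_ge0.
  have := nondecreasing_cvgn_le nd (@term_cvg f g) 1%N.
  by rewrite {1}/series /= big_nat1.
move=> /le_lt_trans /(_ h); rewrite /term expr1 ltr_pM2l ?invr_gt0//.
rewrite ltr_pdivrMr ?ltr_wpDr// mulrAC ltr_pdivlMr ?ltr_wpDl ?(ltW e0)//; lra.
Qed.

End Metric.

Section Density.
Context {R : realType}.
Variable p : nat -> R.
Hypothesis p01 : forall n, 0 < p n < 1.
Hypothesis p_incr : increasing_seq p.
Local Notation T := (hardy_cap_space p).

Lemma ell_inftyP (b : nat -> Cplx R) :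
  ell_infty b <-> exists M : R, forall k, nc (b k) <= M.
Proof.
split=> [[M [Mr MP]]|[M MP]].
- exists (complex.Re M + 1) => k.
  have -> : forall x y : R, (x <= y) = (x%:C <= y%:C)%C by move=> x y; rewrite lecR.
  rewrite -norm_normc; apply: MP => //.
  by rewrite -(RRe_real Mr) ltcR ltrDl.
- exists (M%:C)%C; split; first by rewrite complex_real.
  move=> M' MM' k _ /=; rewrite norm_normc.
  by apply: le_trans (ltW MM'); rewrite lecR.
Qed.

Lemma cap_cdiff (f : T) z : nc z < 1 -> exists D, cdiff f z D.
Proof.
have [/holomorphic_cdiff[hf _] _] := hardy_cap_funP f (p01 0%N).
exact: hf.
Qed.

Definition large_coef (N : nat) : set T :=
  [set f : T | exists k, N%:R < nc (taylor_coef f k)].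

(** A small distance makes the means of order [p 0] of [f - g] small, and these
    control the difference of the coefficients. *)
Lemma open_large_coef N : open (large_coef N).
Proof.
change (hardy_cap_open (large_coef N)) => f [k Nk].
have [p0 p1] := andP (p01 0%N).
have [C [C0 CP]] := taylor_coef_power_mean k (p01 0%N).
pose v := nc (taylor_coef f k) - N%:R; have v0 : 0 < v by rewrite subr_gt0.
pose e := v `^ p 0%N / C.
have e0 : 0 < e by rewrite divr_gt0// powR_gt0.
exists (2^-1 * (e / (1 + e))).
  by rewrite mulr_gt0 ?invr_gt0// divr_gt0// addr_gt0.
move=> g /(hardy_dist_lt e0) fge; exists k.
have hfg : hardy (p 0%N) (f \- g).
  by apply: hardyB => //; apply: hardy_cap_funP.
have [/[dup] hol /holomorphic_cdiff[hd _] _] := hfg.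
have h := CP _ _ hd (fun r => power_mean_le_dist p0 hfg (r := r)).
have {}h : nc (taylor_coef (f \- g) k) < v.
  rewrite ltNge; apply/negP => vn.
  have : v `^ p 0%N <= nc (taylor_coef (f \- g) k) `^ p 0%N.
    by rewrite ge0_ler_powR ?nnegrE ?(ltW p0) ?(ltW v0) ?normc_ge0.
  move=> /le_trans /(_ h); rewrite leNgt => /negP; apply.
  by rewrite mulrC -ltr_pdivlMr.
have fE : (f \- g) \+ g = f :> (Cplx R -> Cplx R).
  by apply/funext => z; rewrite /= subrK.
have := @taylor_coefD R (f \- g) g k hd (@cap_cdiff g).
rewrite fE => /(_ (@cap_cdiff f)) tE.
have := ler_normcD (taylor_coef (f \- g) k) (taylor_coef g k).
by rewrite -tE; move: h; rewrite /v; lra.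
Qed.

Lemma unbounded_taylor_bigcap :
  unbounded_taylor p = \bigcap_N large_coef N.
Proof.
apply/seteqP; split=> f /=.
- move=> unb N _; apply: contrapT => /forallNP h; apply: unb.
  by apply/ell_inftyP; exists N%:R => k; rewrite leNgt; apply/negP; exact: h.
- move=> h /ell_inftyP[M MP].
  have [k] := h (Num.truncn M).+1 Logic.I.
  apply/negP; rewrite -leNgt; exact: le_trans (MP k) (ltW (truncnS_gt M)).
Qed.

(** If the coefficients of [f] are bounded, those of [f + c h] are not. The
    number [N] takes care of the tail of the series defining the distance, and
    [c] of its first [N] terms: the distance for the exponent [p n] is at most
    [c^(p n) K n], and [c^(p n) <= c^(p 0)]. *)
Lemma dense_unbounded_taylor : dense (unbounded_taylor p).
Proof.
move=> O [f Of] /(_ f Of)[e e0 eO].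
have [fb|fu] := pselect (ell_infty (taylor_coef f)); last by exists f.
have [N hN] := @halving_small R 1 (e / 2) ltac:(by rewrite divr_gt0).
have /choice[K KP] : forall n, exists K : R, 0 <= K /\
    forall r, 0 < r < 1 -> power_mean (p n) (@harm_fun R) r <= K.
  move=> n; have [K hK] := @power_mean_harm_fun R _ (p01 n); exists K; split => //.
  apply: le_trans (hK 2^-1 _); first exact: power_mean_ge0.
  by rewrite invr_gt0 ltr0n invf_lt1// ltr1n.
have [p0 p1] := andP (p01 0%N).
pose M := \sum_(n < N) K n.
have M0 : 0 <= M by apply: sumr_ge0 => n _; have [] := KP n.
have M1 : 0 < M + 1 by rewrite ltr_wpDl.
pose d := e / 2 / (M + 1); have d0 : 0 < d by rewrite !divr_gt0.
pose c := Num.min 1 (d `^ (p 0%N)^-1).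
have c0 : 0 < c by rewrite lt_min ltr01 powR_gt0.
have c1 : c <= 1 by rewrite ge_min lexx.
have cd : c `^ p 0%N <= d.
  apply: (@le_trans _ _ ((d `^ (p 0%N)^-1) `^ p 0%N)).
    rewrite ge0_ler_powR ?nnegrE ?(ltW p0) ?(ltW c0) ?powR_ge0//.
    by rewrite ge_min lexx orbT.
  by rewrite -powRrM mulVf ?gt_eqF// powRr1// ltW.
pose ch : Cplx R -> Cplx R := fun z => (c%:C)%C * harm_fun z.
have hch q : 0 < q < 1 -> hardy q ch.
  by move=> q01; apply: hardyZ; [case/andP: q01|exact: hardy_harm_fun].
have gP : hardy_cap (f \+ ch).
  move=> q q01; apply: hardyD; [by case/andP: q01|exact: hardy_cap_funP|exact: hch].
pose g : T := @HardyCapSpace R p _ gP.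
have hh := @cdiff_harm_fun R.
exists g; split.
- apply: eO; rewrite /hardy_cap_ball /=.
  apply: (@le_lt_trans _ _ (e / 2 + 2 ^- N)); last first.
    by rewrite [ltRHS]splitr ltrD2l -[X in X < _]mul1r.
  apply: hardy_cap_dist_le; first by rewrite ltW// divr_gt0.
  move=> n nN; have [pn0 pn1] := andP (p01 n).
  have fgE : f \- g = (fun z => ((- c)%:C)%C * harm_fun z).
    by apply/funext => z; rewrite /= opprD addrA subrr add0r /ch rmorphN mulNr.
  apply: hardy_dist_le => //.
    rewrite fgE; apply: holomorphicZ; by have [] := hardy_harm_fun (p01 n).
  move=> r /[dup] /andP[r0 r1] r01.
  rewrite fgE power_meanZ ?(ltW pn0) ?(ltW r0)//; last exact: cdiff_circle_continuous.
  rewrite normrN gtr0_norm//.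
  have [Kn0 Kn] := KP n.
  have KM : K n <= M.
    rewrite /M (bigD1 (Ordinal nN))//= lerDl sumr_ge0// => i _.
    by have [] := KP i.
  have cn : c `^ p n <= d.
    apply: le_trans cd; apply: ger_powR; first by rewrite c0.
    by rewrite p_incr.
  apply: (@le_trans _ _ (d * M)).
    rewrite ler_pM ?powR_ge0 ?power_mean_ge0//.
    by apply: le_trans KM; apply: Kn.
  by rewrite /d mulrAC ler_pdivrMr// ler_wpM2l ?lerDl// ltW// divr_gt0.
- move=> /ell_inftyP[B BP]; have /ell_inftyP[A AP] := fb.
  have [k hk] := unbounded_harm ((A + B) / c).
  have chd z : nc z < 1 -> exists D, cdiff ch z D.
    by move=> /hh[D dD]; exists ((c%:C)%C * D); exact: cdiffZ.
  have := BP k; rewrite /= (taylor_coefD k (@cap_cdiff f) chd (@cap_cdiff g)).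
  rewrite (taylor_coefZ _ k hh) taylor_coef_harm_fun => hB.
  have := lerB_normcD ((c%:C)%C * harm_coef k) (taylor_coef f k).
  rewrite [(c%:C)%C * _ + _]addrC.
  have -> : nc ((c%:C)%C * harm_coef k) = harm k * c.
    by rewrite normc_mul !normcr (gtr0_norm c0) (ger0_norm (harm_ge0 k)) mulrC.
  have := AP k; move: hB hk; rewrite ltr_pdivrMr//.
  move: (nc _) (nc _) (harm k * c) => x y v; lra.
Qed.

End Density.

Theorem theorem3p1 (R : realType) (p : nat -> R)
    (p01 : forall n, 0 < p n < 1)
    (p_incr : increasing_seq p)
    (p_cvg : p @ \oo --> (1 : R)) :
  Gdelta (unbounded_taylor p) /\ dense (unbounded_taylor p).
Proof.
split; last exact: dense_unbounded_taylor.
exists (@large_coef R p); first exact: (open_large_coef p01).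
exact: unbounded_taylor_bigcap.
Qed.
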